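(* Let $u(x,\rho)=\rho+v(x)\rho^2+w(x)\rho^3+z(x)\rho^4+l(x)\rho^5\log\rho+h(x)\rho^5+O(\rho^6)$ be a formal solution to the singular CR Yamabe problem near nonsingular points $x$ of $\Sigma=\partial M$. Then $$w=-\tfrac23\Big[e_1(\alpha)+2\alpha^2+\tfrac16H^2+\tfrac3{16}R-\tfrac12a_2\Big].$$
   Context: Pseudohermitian notation. $(M,J,\theta)$ is a 3-dimensional pseudohermitian manifold with boundary $\Sigma=\partial M$: $\theta$ is a contact form, $\xi=\ker\theta$, $J:\xi\to\xi$, $J^2=-\mathrm{Id}$, Levi metric $\frac12d\theta(\cdot,J\cdot)$ positive definite on $\xi$; $T$ is the Reeb field; $g_\theta=\langle\cdot,\cdot\rangle=\theta\otimes\theta+\frac12d\theta(\cdot,J\cdot)$; $\nabla$ is the Tanaka--Webster connection with torsion $T_\nabla$. For an orthonormal frame $e_1,e_2=Je_1$ of $\xi$ the real 1-form $\omega$ is given by $\nabla e_1=\omega\otimes e_2$, $\nabla e_2=-\omega\otimes e_1$; $a_1,a_2$ are given by $T_\nabla(T,e_1)=a_1e_1-a_2e_2$, $T_\nabla(T,e_2)=-a_2e_1-a_1e_2$; $W$ is the Webster curvature, $d\omega(e_1,e_2)=-2W$, and $R=2W$. Frame and defining function. A point $x\in\Sigma$ is nonsingular if $T_x\Sigma\neq\xi_x$. At such $x$, $e_1$ is a unit vector in $T_x\Sigma\cap\xi_x$ and $e_2=Je_1$, with sign chosen so that $\langle e_2,\nu\rangle>0$, $\nu$ the unit inner normal;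 $\alpha$ is defined by $V:=T+\alpha e_2\in T\Sigma$, and $H=\omega(e_1)$ on $\Sigma$. Let $\gamma(\rho)=\exp_x(\rho e_2)$ be the solution of $\nabla_{\dot\gamma}\dot\gamma=0$, $\gamma(0)=x$, $\dot\gamma(0)=e_2$. The function $\rho$ is defined near nonsingular points by $\rho(\exp_x(\rho e_2))=\rho$; functions are written as $u(x,\rho)=u(\exp_x(\rho e_2))$. The frame is extended by $e_2:=\dot\gamma=\partial_\rho$, $e_1:=-Je_2$ (so $\omega(e_2)=0$). Formal solution. Put $\triangle_Pu=e_1e_1(u)+e_2e_2(u)-\omega(e_1)e_2(u)+\omega(e_2)e_1(u)$ and $|d_Pu|^2=e_1(u)^2+e_2(u)^2$. The singular CR Yamabe problem asks for $u>0$ inside $M$, $u=0$ on $\Sigma$, such that $u^{-2}\theta$ has Webster curvature $-4$. A formal solution is a function $u$, positive for $\rho>0$ small, with an expansion (differentiable term by term, smooth coefficients on the nonsingular part of $\Sigma$) $u=c(x)\rho+v(x)\rho^2+w(x)\rho^3+z(x)\rho^4+l(x)\rho^5\log\rho+h(x)\rho^5+O(\rho^6)$ satisfying $|d_Pu|^2-\frac12u\triangle_Pu-\frac18Ru^2=1+O(\rho^5\log\rho)$; then $c\equiv1$. *)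

(* Defs.v *)
From HB Require Import structures.
From mathcomp Require Import all_boot all_order all_algebra.
From mathcomp Require Import all_classical all_reals all_analysis.

Set Implicit Arguments.
Unset Strict Implicit.
Unset Printing Implicit Defensive.

Import Order.TTheory GRing.Theory Num.Theory.
Import numFieldNormedType.Exports.

Local Open Scope classical_set_scope.
Local Open Scope ring_scope.

Section SmoothFunctions.
Context {R : realType}.
Implicit Types (U : set 'rV[R]_3) (f : 'rV[R]_3 -> R^o).

Fixpoint Ck (k : nat) U f : Prop :=
  (forall y, U y -> {for y, continuous f}) /\
  if k is k'.+1 then
    forall v, (forall y, U y -> derivable f y v) /\ Ck k' U ('D_v f)
  else True.

Definition Cinfty U f : Prop := forall k, Ck k U f.

Definition half_space : set 'rV[R]_3 := [set y | 0 <= y ord0 ord0].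

Definition half_smooth_at f (x : 'rV[R]_3) : Prop :=
  exists U F, [/\ open U, U x, Cinfty U F
                & forall y, U y -> half_space y -> f y = F y].

End SmoothFunctions.

Section Charts.
Context {R : realType} {M : topologicalType}.

Record chart := Chart {
  cdom : set M;
  cmap : M -> 'rV[R]_3;
  cinv : 'rV[R]_3 -> M;
  cdom_open : open cdom;
  cmapK : {in cdom, cancel cmap cinv};
  cmap_image : exists2 O, open O & cmap @` cdom = O `&` half_space;
  cmap_continuous : {within cdom, continuous cmap};
  cinv_continuous : {within cmap @` cdom, continuous cinv} }.

Definition compatible (c c' : chart) : Prop :=
  forall p, cdom c p -> cdom c' p -> forall i : 'I_3,
    half_smooth_at (fun y => cmap c' (cinv c y) ord0 i) (cmap c p).

End Charts.
Arguments chart : clear implicits.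

Record manifold (R : realType) := Manifold {
  mpoint :> topologicalType;
  atlas : set (chart R mpoint);
  manifold_hausdorff : hausdorff_space mpoint;
  manifold_second_countable : @second_countable mpoint;
  atlas_cover : forall p, exists2 c, atlas c & cdom c p;
  atlas_compatible : forall c c', atlas c -> atlas c' -> compatible c c' }.

Section Calculus.
Context {R : realType} {M : manifold R}.
Implicit Types (p q : M) (f : M -> R) (W : set M).

Definition boundary : set M :=
  [set p | exists c, [/\ atlas c, cdom c p & cmap c p ord0 ord0 = 0]].

Definition smooth_at p f : Prop :=
  \forall q \near p, forall c : chart R M, atlas c -> cdom c q ->
    half_smooth_at (f \o cinv c) (cmap c q).

Definition smooth_on W f : Prop := forall p, W p -> smooth_at p f.

(* Smoothness of a function that is only relevant on S, a subset of the
   boundary: locally it is the restriction of a smooth function on M. *)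
Definition smooth_on_boundary (S : set M) f : Prop :=
  forall p, S p -> exists2 F, smooth_at p F
    & \forall q \near p, boundary q -> F q = f q.

Definition smooth_map_on W (phi : M -> M) : Prop :=
  forall p, W p -> {for p, continuous phi} /\
    forall f, smooth_at (phi p) f -> smooth_at p (f \o phi).

(** Tangent vectors at [p] are the derivations of germs at [p] of smooth
    functions.  They are represented by functionals on all functions, with
    value 0 on those that are not smooth near [p], so that equality of tangent
    vectors is Leibniz equality and their linear structure is pointwise. *)

Definition vec : Type := (M -> R) -> R^o.

Definition tangent p : set vec := [set v |
  [/\ forall f g, (\forall q \near p, f q = g q) -> v f = v g,
      forall a f g, smooth_at p f -> smooth_at p g ->
        v (fun q => a * f q + g q) = a * v f + v g,
      forall f g, smooth_at p f -> smooth_at p g ->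
        v (fun q => f q * g q) = f p * v g + g p * v f
    & forall f, ~ smooth_at p f -> v f = 0 ] ].

Definition boundary_tangent p : set vec := [set v | tangent p v /\
  forall f, smooth_at p f ->
    (\forall q \near p, boundary q -> f q = 0) -> v f = 0].

(* By the first chart coordinate, which vanishes on the boundary
   and is positive in the interior. *)
Definition inward p (v : vec) : Prop :=
  forall c : chart R M, atlas c -> cdom c p ->
    0 < v (fun q => cmap c q ord0 ord0).

(* [v] is the velocity, at time [s], of the curve [gam : [0, d[ -> M]; it is
   one-sided at [s = 0]. *)
Definition velocity (gam : R -> M) (d s : R) (v : vec) : Prop :=
  forall f, smooth_at (gam s) f ->
    (t - s)^-1 * (f (gam t) - f (gam s))
      @[t --> within [set t | 0 <= t < d] s^'] --> (v f : R).

Definition vf : Type := M -> vec.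

Definition vfield W (X : vf) : Prop :=
  (forall p, W p -> tangent p (X p)) /\
  (forall p f, W p -> smooth_at p f -> smooth_at p (fun q => X q f)).

Definition apply_vf (X : vf) f : M -> R := fun q => X q f.

Definition bracket (X Y : vf) : vf := fun p f =>
  if `[< smooth_at p f >] then X p (apply_vf Y f) - Y p (apply_vf X f) else 0.

Definition form1 : Type := M -> vec -> R.

Definition oneform W (om : form1) : Prop :=
  (forall p a v w, W p -> tangent p v -> tangent p w ->
     om p (a *: v + w) = a * om p v + om p w) /\
  (forall O X, open O -> O `<=` W -> vfield O X ->
     smooth_on O (fun q => om q (X q))).

(* dom(X, Y) = X om(Y) - Y om(X) - om([X, Y]), without a factor 1/2. *)
Definition d1 (om : form1) (X Y : vf) : M -> R := fun p =>
  X p (fun q => om q (Y q)) - Y p (fun q => om q (X q)) - om p (bracket X Y p).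

(* [nab p v Y] is the covariant derivative of [Y] at [p] in the direction [v]. *)
Definition covd : Type := M -> vec -> vf -> vec.

Record connection (nab : covd) : Prop := {
  conn_tangent : forall W p v Y, open W -> W p -> tangent p v -> vfield W Y ->
    tangent p (nab p v Y);
  conn_smooth : forall W X Y, open W -> vfield W X -> vfield W Y ->
    vfield W (fun p => nab p (X p) Y);
  conn_local : forall W p v Y Z, open W -> W p -> tangent p v ->
    vfield W Y -> vfield W Z -> (forall q, W q -> Y q = Z q) ->
    nab p v Y = nab p v Z;
  conn_linear : forall W p a v w Y, open W -> W p ->
    tangent p v -> tangent p w -> vfield W Y ->
    nab p (a *: v + w) Y = a *: nab p v Y + nab p w Y;
  conn_add : forall W p v Y Z, open W -> W p -> tangent p v ->
    vfield W Y -> vfield W Z ->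
    nab p v (fun q => Y q + Z q) = nab p v Y + nab p v Z;
  conn_leibniz : forall W p v f Y, open W -> W p -> tangent p v ->
    smooth_on W f -> vfield W Y ->
    nab p v (fun q => f q *: Y q) = v f *: Y p + f p *: nab p v Y }.

Definition torsion (nab : covd) (X Y : vf) : vf := fun p =>
  nab p (X p) Y - nab p (Y p) X - bracket X Y p.

(* For a curve with nowhere vanishing velocity, as here: the velocity extends
   locally to a vector field [E], and its covariant derivative along the curve
   is that of any such extension. *)
Definition geodesic (nab : covd) (gam : R -> M) (d : R) : Prop :=
  forall s, 0 <= s < d -> forall W E, open W -> W (gam s) -> vfield W E ->
    (forall t, 0 <= t < d -> W (gam t) -> velocity gam d t (E (gam t))) ->
    nab (gam s) (E (gam s)) E = 0.

End Calculus.
Arguments vec {R} M.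
Arguments vf {R} M.
Arguments form1 {R} M.
Arguments covd {R} M.
Arguments boundary {R} M.

Section Pseudohermitian.
Context {R : realType} {M : manifold R}.

Definition contact_plane (theta : form1 M) (p : M) : set (vec M) :=
  [set v | tangent p v /\ theta p v = 0].

Record pseudohermitian := Pseudohermitian {
  theta : form1 M;
  dtheta : M -> vec M -> vec M -> R;
  J : M -> vec M -> vec M;
  reeb : vf M;
  theta_form : oneform setT theta;
  dthetaE : forall W X Y, open W -> vfield W X -> vfield W Y ->
    forall p, W p -> dtheta p (X p) (Y p) = d1 theta X Y p;
  theta_neq0 : forall p, exists2 v, tangent p v & theta p v != 0;
  theta_contact : forall p v, contact_plane theta p v ->
    (forall w, contact_plane theta p w -> dtheta p v w = 0) -> v = 0;
  J_plane : forall p v, contact_plane theta p v -> contact_plane theta p (J p v);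
  J_linear : forall p a v w, contact_plane theta p v -> contact_plane theta p w ->
    J p (a *: v + w) = a *: J p v + J p w;
  J_square : forall p v, contact_plane theta p v -> J p (J p v) = - v;
  J_smooth : forall W X, open W -> vfield W X ->
    (forall p, W p -> contact_plane theta p (X p)) ->
    vfield W (fun p => J p (X p));
  levi_positive : forall p v, contact_plane theta p v -> v != 0 ->
    0 < dtheta p v (J p v);
  reeb_field : vfield setT reeb;
  reeb_theta : forall p, theta p (reeb p) = 1;
  reeb_dtheta : forall p v, tangent p v -> dtheta p (reeb p) v = 0 }.

Variable P : pseudohermitian.

Definition xi (p : M) : set (vec M) := contact_plane (theta P) p.

(* The Levi metric is extended by 0 to the Reeb direction, i.e. it is applied
   to the projections on the contact plane; d theta(T, .) = 0 makes the
   projection of the first argument unnecessary. *)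
Definition metric (p : M) (v w : vec M) : R :=
  theta P p v * theta P p w
  + 2^-1 * dtheta P p v (J P p (w - theta P p w *: reeb P p)).

Definition section_xi (W : set M) (Y : vf M) : Prop :=
  vfield W Y /\ forall p, W p -> xi p (Y p).

Record tanaka_webster (nab : covd M) : Prop := {
  tw_connection : connection nab;
  tw_plane : forall W p v Y, open W -> W p -> tangent p v ->
    section_xi W Y -> xi p (nab p v Y);
  tw_reeb : forall p v, tangent p v -> nab p v (reeb P) = 0;
  tw_J : forall W p v Y, open W -> W p -> tangent p v -> section_xi W Y ->
    nab p v (fun q => J P q (Y q)) = J P p (nab p v Y);
  tw_metric : forall W p v Y Z, open W -> W p -> tangent p v ->
    vfield W Y -> vfield W Z ->
    v (fun q => metric q (Y q) (Z q)) =
      metric p (nab p v Y) (Z p) + metric p (Y p) (nab p v Z);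
  tw_torsion_plane : forall W p X Y, open W -> W p ->
    section_xi W X -> section_xi W Y ->
    torsion nab X Y p = dtheta P p (X p) (Y p) *: reeb P p;
  tw_torsion_reeb : forall W p Y, open W -> W p -> section_xi W Y ->
    torsion nab (reeb P) (fun q => J P q (Y q)) p =
      - J P p (torsion nab (reeb P) Y p) }.

(* As [f2 = J f1], the remaining orthonormality relations are automatic. *)
Definition orthonormal_frame (W : set M) (f1 f2 : vf M) : Prop :=
  [/\ section_xi W f1, section_xi W f2,
      forall p, W p -> metric p (f1 p) (f1 p) = 1
    & forall p, W p -> f2 p = J P p (f1 p)].

Definition connection_form (nab : covd M) (W : set M) (f1 f2 : vf M)
    (om : form1 M) : Prop :=
  oneform W om /\
  forall p v, W p -> tangent p v ->
    nab p v f1 = om p v *: f2 p /\ nab p v f2 = - om p v *: f1 p.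

Definition webster_curvature (nab : covd M) (K : M -> R) : Prop :=
  forall W f1 f2 om, open W -> orthonormal_frame W f1 f2 ->
    connection_form nab W f1 f2 om ->
    forall p, W p -> d1 om f1 f2 p = - 2 * K p.

Definition torsion_coefficients (nab : covd M) (W : set M) (f1 f2 : vf M)
    (a1 a2 : M -> R) : Prop :=
  forall p, W p ->
    torsion nab (reeb P) f1 p = a1 p *: f1 p - a2 p *: f2 p /\
    torsion nab (reeb P) f2 p = - a2 p *: f1 p - a1 p *: f2 p.

Definition nonsingular (p : M) : Prop :=
  boundary M p /\ boundary_tangent p <> xi p.

Definition unit_inner_normal (p : M) (n : vec M) : Prop :=
  [/\ tangent p n, inward p n, metric p n n = 1
    & forall v, boundary_tangent p v -> metric p n v = 0].

(** A one-sided neighbourhood [U] of the piece [boundary M `&` U] of the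
    nonsingular part of the boundary, filled by the geodesics issued from it:
    [p |-> (foot p, rho p)] is the inverse of [(x, s) |-> ex x s], where
    [ex x s] stands for exp_x(s e2), [0 <= s < delta x]; and [e1], [e2] is the
    frame adapted to the boundary, extended along the geodesics. *)
Record geodesic_collar (nab : covd M) (U : set M) (delta : M -> R)
    (ex : M -> R -> M) (foot : M -> M) (rho : M -> R) (e1 e2 : vf M) : Prop := {
  collar_open : open U;
  collar_nonsingular : forall x, boundary M x -> U x -> nonsingular x;
  collar_e2 : vfield U e2;
  collar_e1 : forall p, U p -> e1 p = - J P p (e2 p);
  collar_e1_unit : forall x, boundary M x -> U x ->
    [/\ boundary_tangent x (e1 x), xi x (e1 x) & metric x (e1 x) (e1 x) = 1];
  collar_e2_J : forall x, boundary M x -> U x -> e2 x = J P x (e1 x);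
  collar_e2_sign : forall x n, boundary M x -> U x -> unit_inner_normal x n ->
    0 < metric x (e2 x) n;
  collar_ex0 : forall x, boundary M x -> U x -> 0 < delta x /\ ex x 0 = x;
  collar_geodesic : forall x, boundary M x -> U x ->
    geodesic nab (ex x) (delta x);
  collar_velocity : forall x s, boundary M x -> U x -> 0 <= s < delta x ->
    velocity (ex x) (delta x) s (e2 (ex x s));
  collar_exK : forall x s, boundary M x -> U x -> 0 <= s < delta x ->
    [/\ U (ex x s), foot (ex x s) = x & rho (ex x s) = s];
  collar_footK : forall p, U p ->
    [/\ boundary M (foot p), U (foot p), 0 <= rho p < delta (foot p)
      & ex (foot p) (rho p) = p];
  collar_foot_smooth : smooth_map_on U foot;
  collar_rho_smooth : smooth_on U rho }.

Definition sublaplacian (e1 e2 : vf M) (om : form1 M) (u : M -> R) : M -> R :=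
  fun p => e1 p (apply_vf e1 u) + e2 p (apply_vf e2 u)
    - om p (e1 p) * e2 p u + om p (e2 p) * e1 p u.

Definition sq_dP (e1 e2 : vf M) (u : M -> R) : M -> R :=
  fun p => e1 p u ^+ 2 + e2 p u ^+ 2.

Definition scalar_curvature (K : M -> R) : M -> R := fun p => 2 * K p.

(* Coefficients, given on the boundary, are read at the foot point. *)
Definition expansion (foot : M -> M) (rho v w z l h : M -> R) : M -> R :=
  fun p => rho p + v (foot p) * rho p ^+ 2 + w (foot p) * rho p ^+ 3
    + z (foot p) * rho p ^+ 4 + l (foot p) * (rho p ^+ 5 * ln (rho p))
    + h (foot p) * rho p ^+ 5.

(* Term by term differentiability: k derivatives of the O(rho^6) remainder are
   O(rho^(6 - k)).  All O are along each geodesic, the weakest reading. *)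
Record formal_solution (U : set M) (ex : M -> R -> M) (foot : M -> M)
    (rho : M -> R) (e1 e2 : vf M) (om : form1 M) (K : M -> R)
    (u v w z l h : M -> R) : Prop := {
  fs_smooth : smooth_on (U `\` boundary M) u;
  fs_positive : forall x, boundary M x -> U x ->
    \forall s \near 0^'+, 0 < u (ex x s);
  fs_coef_smooth :
    [/\ smooth_on_boundary (boundary M `&` U) v,
        smooth_on_boundary (boundary M `&` U) w,
        smooth_on_boundary (boundary M `&` U) z,
        smooth_on_boundary (boundary M `&` U) l
      & smooth_on_boundary (boundary M `&` U) h];
  fs_expansion : forall (Xs : seq (vf M)),
    (forall i, (i < size Xs)%N -> vfield U (nth e1 Xs i)) ->
    forall x, boundary M x -> U x ->
    (fun s : R => foldr apply_vf (fun p => u p - expansion foot rho v w z l h p) Xs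
                    (ex x s) : R^o)
      =O_ (0^'+) (fun s : R => s ^ (6%:Z - (size Xs)%:Z) : R^o);
  fs_equation : forall x, boundary M x -> U x ->
    (fun s : R => let p := ex x s in
       sq_dP e1 e2 u p - 2^-1 * u p * sublaplacian e1 e2 om u p
         - 8^-1 * scalar_curvature K p * u p ^+ 2 - 1 : R^o)
      =O_ (0^'+) (fun s : R => s ^+ 5 * ln s : R^o) }.

End Pseudohermitian.
Arguments pseudohermitian {R} M.

(* Main.v *)
Require Import Defs.
From HB Require Import structures.
From mathcomp Require Import all_boot all_order all_algebra.
From mathcomp Require Import all_classical all_reals all_analysis.
From mathcomp Require Import ring lra zify.
Import Order.TTheory GRing.Theory Num.Theory.
Import numFieldNormedType.Exports.
Local Open Scope classical_set_scope.
Local Open Scope ring_scope.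
Set Implicit Arguments.
Unset Strict Implicit.

(** Along the geodesic issued from a boundary point [x], where [rho = s] and the
    foot is constant, the equation
      [|d_P u|^2 - u sublaplacian(u) / 2 - R u^2 / 8 = 1]
    becomes an identity between functions of [s], and the formula for [w]
    is its coefficient of [s ^ 2] once the coefficient of [s] has
    given [v = - H / 6] ([compare_coefficients]).

    The derivatives along [e2] are read off the expansion, because
    [e2 rho = 1] and [e2] kills functions of the foot ([expansion_e2]).  The
    derivatives along [e1] are of order [s]: only [e1 rho] and [e1 (e1 rho)]
    contribute to it, and these functions vanish at [x] with first order terms
    given by [e2 (e1 rho)] and [e2 (e1 (e1 rho))] ([expansion_e1]).  The
    remaining input is the first order term [e2 (om e1)] of [om e1].

    These derivatives at [x] come from commutators.  The function
    [metric e2 e2] and the form [theta] evaluated on [e2] are constant along the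
    geodesics, since [e2] and the Reeb field [T] are parallel along them;
    hence [e1, e2] is an orthonormal frame of the contact planes on the whole
    collar ([collar_frame]) and [om e2 = 0].  The torsion and the curvature
    then give [[e1, e2] = - om(e1) e1 - 2 T] ([collar_bracket]),
    [[T, e1] = om(T) e2 - a1 e1 + a2 e2] ([collar_bracket_reeb]) and
    [e2 (om e1) = om(e1)^2 + 2 om(T) + 2 W] ([collar_curvature]).  Applied to
    [rho] and to [e1 rho], and combined with the tangency of [e1] and
    [T + alpha e2] to the boundary, on which [rho] and [e1 rho] vanish, they give
      [e2 (e1 rho) = - 2 alpha], [e2 (e1 (e1 rho)) = 4 alpha^2 - 2 e1 alpha],
      [om(T) = e1 alpha + 2 alpha^2 - a2].

    Differentiating the term [l rho^5 ln rho] along [e1] requires the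
    smoothness of [ln rho] and the rule [e1 (ln rho) = e1 rho / rho], for a
    tangent vector that is only a derivation of germs.  The rule follows from
    a factorization [ln t = (t - 1) G(t)] with [G] smooth and [G 1 = 1]
    ([tangent_ln]); the smoothness of [G] is obtained from a family of functions
    that contains [ln] and [G] and is closed under differentiation ([ln_quot]). *)

(** * Iterated quotients of the logarithm *)
Section LogQuotients.
Context {R : realType}.
Implicit Types (m : nat) (t : R).

Definition ln_coef m : R := - (-1) ^+ m / m%:R.

(** The remainder of order [m] of the Taylor expansion of [ln] at 1, divided by
    [(t - 1) ^ m]; the value at 1 is the one that makes it continuous.  Keeping
    all orders gives a family that is closed under differentiation. *)
Fixpoint ln_quot m t : R :=
  if m is m'.+1 then
    if t == 1 then ln_coef m else (ln_quot m' t - ln_coef m') / (t - 1)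
  else ln t.

Lemma ln_quot1 m : ln_quot m 1 = ln_coef m.
Proof. by case: m => [|m] /=; rewrite ?ln1 /ln_coef ?invr0 ?mulr0 ?eqxx. Qed.

(** With [m = 0], this is the factorization [ln t = (t - 1) * ln_quot 1 t]. *)
Lemma ln_quotS m t : ln_quot m t = ln_coef m + (t - 1) * ln_quot m.+1 t.
Proof.
have [->|t1] := eqVneq t 1; first by rewrite ln_quot1 subrr mul0r addr0.
have tn0 : t - 1 != 0 by rewrite subr_eq0.
by rewrite /= (negbTE t1) [_ / _]mulrC mulVKf // addrC subrK.
Qed.

Lemma ln_coefS m : m.+1%:R * ln_coef m.+1 = (-1) ^+ m.
Proof.
have mn0 : m.+1%:R != 0 :> R by rewrite pnatr_eq0.
by rewrite /ln_coef exprS mulrCA mulrV ?unitfE // mulr1 mulN1r opprK.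
Qed.

(* The derivative of [ln_quot m]: differentiating [(t - 1) ^ m * ln_quot m t]
   gives [(t - 1) * f' + m * f = - (-1) ^ m / t] for [f = ln_quot m] with [m > 0],
   where [f] is [ln_coef m + (t - 1) * ln_quot m.+1 t]. *)
Let dquot m t : R := (-1) ^+ m / t - m%:R * ln_quot m.+1 t.

Lemma is_derive_ln_quot_neq1 m t : 0 < t -> t != 1 ->
  is_derive t 1 (ln_quot m) (dquot m t).
Proof.
move=> t0 t1; have tn0 : t - 1 != 0 by rewrite subr_eq0.
elim: m => [|m IH].
  by apply: is_derive_eq (is_derive1_ln t0) _; rewrite /dquot expr0 mul1r mul0r subr0.
pose f (x : R) := (ln_quot m x - ln_coef m) * (x - 1)^-1.
have near_f : \forall x \near t, f x = ln_quot m.+1 x.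
  have : \forall x \near t, x != 1 by exact: open_neq.
  by apply: filterS => x x1; rewrite /f /= (negbTE x1).
apply: near_eq_is_derive near_f _.
have d1 : is_derive t 1 (fun x => ln_quot m x - ln_coef m) (dquot m t).
  by apply: is_derive_eq; rewrite subr0.
have d2 : is_derive t 1 (fun x : R => x - 1) 1.
  by apply: is_derive_eq; rewrite subr0.
have d3 := @is_deriveV _ (fun x : R => x - 1) t 1 1 tn0 d2.
apply: is_derive_eq (is_deriveM d1 d3) _.
have E1 : ln_quot m t - ln_coef m = (t - 1) * ln_quot m.+1 t.
  by rewrite (ln_quotS m) addrC addKr.
rewrite /dquot /GRing.scale /= -[if _ then _ else _]/(ln_quot m.+1 t).
rewrite -[if _ then _ else _]/(ln_quot m.+2 t) E1 (ln_quotS m.+1).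
rewrite [(-1) ^+ m.+1]exprS -(ln_coefS m) -natr1.
by field; rewrite tn0 gt_eqF.
Qed.

(** The Taylor remainder [(t - 1) ^ m.+1 * ln_quot m.+1 t] vanishes at 1 and has
    derivative [(1 - t) ^ m / t], of absolute value at most [2 * |t - 1| ^ m]; the
    mean value theorem concludes.  This bound is what makes [ln_quot m]
    continuous at 1. *)
Lemma ln_quot_bound m t : `|t - 1| < 2^-1 -> `|ln_quot m.+1 t| <= 2.
Proof.
move=> t1.
pose r m (x : R) := (x - 1) ^+ m * ln_quot m x.
have rS m' : r m'.+1 = fun x => r m' x - ln_coef m' * (x - 1) ^+ m'.
  by apply/funext => x; rewrite /r (ln_quotS m') exprS; ring.
have dr m' (x : R) : 0 < x -> is_derive x 1 (r m'.+1) ((- (x - 1)) ^+ m' / x).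
  move=> x0; have xn0 : x != 0 by rewrite gt_eqF.
  elim: m' => [|m' IH]; rewrite rS.
    have -> : (fun y => r 0%N y - ln_coef 0 * (y - 1) ^+ 0) = @ln R.
      by apply/funext => y; rewrite /r /ln_coef /= invr0 expr0; ring.
    by apply: is_derive_eq (is_derive1_ln x0) _; rewrite expr0 mul1r.
  have d2 : is_derive x 1 (fun y : R => y - 1) 1.
    by apply: is_derive_eq; rewrite subr0.
  have := is_deriveX m'.+1 d2; rewrite exprfctE => d3.
  have d4 : is_derive x 1 (fun y : R => ln_coef m'.+1 * (y - 1) ^+ m'.+1)
     (ln_coef m'.+1 * ((m'.+1%:R * (x - 1) ^+ m') *: 1)).
    exact: is_deriveZ d3.
  apply: is_derive_eq (is_deriveB IH d4) _.
  rewrite /GRing.scale /= mulr1 mulrA [ln_coef _ * _]mulrC ln_coefS.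
  rewrite -[in X in _ - X]exprMn mulN1r exprS.
  by field.
have rn m' : r m'.+1 1 = 0 by rewrite /r subrr expr0n mul0r.
have [->|tn1] := eqVneq t 1.
  rewrite ln_quot1 /ln_coef normrM normrN normrX normrN1 expr1n mul1r.
  rewrite normfV normr_nat; apply: (@le_trans _ _ 1); last by rewrite ler1n.
  by rewrite invf_le1 ?ltr0n // ler1n.
(* The mean value theorem is for an ordered pair of points: 1 is either the left or
   the right one. *)
have rb (x y : R) : x < y -> `|x - 1| < 2^-1 -> `|y - 1| < 2^-1 ->
    exists2 c, `|c - 1| <= Num.max `|x - 1| `|y - 1| &
      [/\ 0 < c, 2^-1 < c &
        r m.+1 y - r m.+1 x = (- (c - 1)) ^+ m / c * (y - x)].
  move=> xy x1 y1.
  have xp : 2^-1 < x by move: x1; rewrite ltr_norml; lra.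
  have [z||z zxy ->] := @MVT R (r m.+1) (fun z => (- (z - 1)) ^+ m / z) x y xy.
  - by rewrite in_itv /= => zxy; apply: dr; lra.
  - apply: derivable_within_continuous => z; rewrite in_itv /= => zxy.
    by have [] := dr m z _; first lra.
  - exists z => //; move: zxy; rewrite in_itv /= => /andP[xz zy].
      rewrite le_max; have [z1|z1] := leP 1 z.
        by apply/orP; right; rewrite !ger0_norm ?subr_ge0; lra.
      by apply/orP; left; rewrite !ler0_norm ?subr_le0; lra.
    by split=> //; lra.
have [c c1 [c0 cp E]] : exists2 c, `|c - 1| <= `|t - 1| &
      [/\ 0 < c, 2^-1 < c & r m.+1 t = (- (c - 1)) ^+ m / c * (t - 1)].
  have n1 : `|1 - 1 : R| < 2^-1 by rewrite subrr normr0; lra.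
  have [lt1|gt1|] := ltgtP t 1; last by move/eqP; rewrite (negbTE tn1).
    have [c c1 [c0 cp]] := rb _ _ lt1 t1 n1.
    rewrite rn => E; exists c; last by split=> //; move: E; nra.
    by move: c1; rewrite subrr normr0 max_l.
  have [c c1 [c0 cp]] := rb _ _ gt1 n1 t1.
  rewrite rn => E; exists c; last by split=> //; move: E; nra.
  by move: c1; rewrite subrr normr0 max_r.
have tp : 0 < `|t - 1| by rewrite normr_gt0 subr_eq0.
have /(congr1 Num.norm) := E.
rewrite /r !normrM normrX normfV normrX normrN (gtr0_norm c0) exprSr => E'.
have {}E' : `|t - 1| ^+ m * `|ln_quot m.+1 t| = `|c - 1| ^+ m / c.
  by apply: (mulIf (lt0r_neq0 tp)); rewrite -E'; ring.
rewrite -(ler_pM2l (exprn_gt0 m tp)) E'.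
apply: ler_pM; [exact: exprn_ge0|by rewrite invr_ge0 ltW| |].
  by rewrite lerXn2r ?nnegrE ?normr_ge0.
by rewrite -[leRHS]invrK lef_pV2 ?posrE ?invr_gt0 // ltW.
Qed.

Arguments ln_quot : simpl never.

(** At 1, the difference quotient of [ln_quot m] is [ln_quot m.+1], which tends to
    its value because [ln_quot m.+2] is bounded. *)
Lemma is_derive_ln_quot m t : 0 < t -> is_derive t 1 (ln_quot m) (dquot m t).
Proof.
move=> t0; have [->|t1] := eqVneq t 1; last exact: is_derive_ln_quot_neq1.
have E : dquot m 1 = ln_coef m.+1.
  by rewrite /dquot ln_quot1 divr1 -ln_coefS -natr1; ring.
rewrite E.
have dq : (fun h : R => h^-1 *: (ln_quot m (h *: 1 + 1) - ln_quot m 1)) @ 0^' -->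
    ln_coef m.+1.
  apply/cvgrPdist_lt => e e0; near=> h.
  have hn0 : h != 0 by near: h; exact: nbhs_dnbhs_neq.
  have hs : `|h| < Num.min (2^-1) (e / 4).
    near: h; apply: dnbhs0_lt.
    by rewrite lt_min; apply/andP; split; lra.
  have := hs; rewrite lt_min => /andP[h1 h2].
  have -> : h *: 1 + 1 = 1 + h :> R by rewrite /GRing.scale /= mulr1 addrC.
  have q1 : 1 + h - 1 = h by rewrite addrC addKr.
  rewrite (ln_quotS m) ln_quot1 (ln_quotS m.+1) q1 [ln_coef m + _]addrC addrK.
  rewrite /GRing.scale /= mulKf // opprD addNKr normrN normrM.
  have := @ln_quot_bound m.+1 (1 + h); rewrite q1 => /(_ h1) b.
  apply: le_lt_trans (ler_wpM2l (normr_ge0 h) b) _; lra.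
apply: DeriveDef; first by apply/cvg_ex; exists (ln_coef m.+1).
exact: cvg_lim dq.
Unshelve. all: by end_near. Qed.

End LogQuotients.

(** * Smooth functions in charts *)
Section CkAlgebra.
Context {R : realType}.
Implicit Types (k m : nat) (U V : set 'rV[R]_3) (f g : 'rV[R]_3 -> R^o).

Lemma Ck_cont k U f y : Ck k U f -> U y -> {for y, continuous f}.
Proof. by case: k => [|k] [c _]; exact: c. Qed.

Lemma Ck_sub k U V f : V `<=` U -> Ck k U f -> Ck k V f.
Proof.
move=> VU; elim: k f => [|k IH] f [c d]; split=> //; try by move=> y /VU; exact: c.
by move=> v; have [d1 d2] := d v; split; [move=> y /VU; exact: d1|exact: IH].
Qed.

Lemma Ck_pred k U f : Ck k.+1 U f -> Ck k U f.
Proof.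
elim: k f => [|k IH] f [c d]; split=> // v.
by have [d1 d2] := d v; split=> //; exact: IH.
Qed.

Lemma Ck_ext k U f g : open U -> (forall y, U y -> f y = g y) ->
  Ck k U f -> Ck k U g.
Proof.
move=> oU; elim: k f g => [|k IH] f g fg [c d].
all: have nfg y : U y -> \forall z \near y, f z = g z.
1,3: by move=> Uy; apply: filterS (open_nbhs_nbhs (conj oU Uy)) => z; exact: fg.
all: have cg y : U y -> {for y, continuous g}.
1,3: move=> Uy; change (g @ y --> g y); rewrite -(fg y Uy);
  apply: cvg_trans (c y Uy); exact: near_eq_cvg (nfg y Uy).
all: split=> // v; have [d1 d2] := d v; split.
  by move=> y Uy; exact: near_eq_derivable (nfg y Uy) (d1 y Uy).
by apply: (IH _ _ _ d2) => y Uy; exact: near_eq_derive (nfg y Uy).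
Qed.

Lemma Ck_cst k U (a : R) : Ck k U (fun=> a).
Proof.
have c b : forall y, U y -> {for y, continuous ((fun=> b) : 'rV[R]_3 -> R^o)}.
  by move=> y _; exact: cst_continuous.
elim: k a => [|k IH] a; split; [exact: c|by []|exact: c|].
move=> v; split; first by move=> y _; exact: (derivable_cst (a : R^o) y v).
have -> : 'D_v (fun=> a : R^o) = (fun=> 0) :> ('rV[R]_3 -> R^o).
  by apply/funext => y; exact: (derive_cst (a : R^o) y v).
exact: IH.
Qed.

Lemma Ck_add k U f g : open U -> Ck k U f -> Ck k U g ->
  Ck k U (fun y => f y + g y).
Proof.
move=> oU; elim: k f g => [|k IH] f g [cf df] [cg dg]; split=> //.
1,2: by move=> y Uy; apply: continuousD; [exact: cf|exact: cg].
move=> v; have [df1 df2] := df v; have [dg1 dg2] := dg v; split.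
  by move=> y Uy; apply: derivableD; [exact: df1|exact: dg1].
apply: Ck_ext oU _ (IH _ _ df2 dg2) => y Uy.
by rewrite -(deriveD (df1 y Uy) (dg1 y Uy)).
Qed.

Lemma Ck_mul k U f g : open U -> Ck k U f -> Ck k U g ->
  Ck k U (fun y => f y * g y).
Proof.
move=> oU; elim: k f g => [|k IH] f g Cf Cg;
  have [[cf df] [cg dg]] := (Cf, Cg); split=> //.
1,2: by move=> y Uy; apply: continuousM; [exact: cf|exact: cg].
move=> v; have [df1 df2] := df v; have [dg1 dg2] := dg v; split.
  by move=> y Uy; apply: derivableM; [exact: df1|exact: dg1].
apply: Ck_ext oU _ (Ck_add oU (IH _ _ (Ck_pred Cf) dg2)
  (IH _ _ (Ck_pred Cg) df2)) => // y Uy.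
by rewrite -[in RHS]/(f * g) (deriveM (df1 y Uy) (dg1 y Uy)).
Qed.

Lemma Ck_inv k U f : open U -> (forall y, U y -> 0 < f y) -> Ck k U f ->
  Ck k U (fun y => (f y)^-1).
Proof.
move=> oU f0; have fn0 y : U y -> f y != 0 by move=> /f0; rewrite lt0r => /andP[].
elim: k => [|k IH] Cf; have [cf df] := Cf; split=> //.
1,2: by move=> y Uy; apply: continuousV; [exact: fn0|exact: cf].
move=> v; have [df1 df2] := df v; split.
  by move=> y Uy; apply: derivableV; [exact: fn0|exact: df1].
have Ci := IH (Ck_pred Cf).
have := Ck_mul oU (Ck_cst k U (-1))
  (Ck_mul oU (Ck_mul oU Ci Ci) df2).
apply: Ck_ext oU _ => y Uy.
rewrite (deriveV (fn0 y Uy) (df1 y Uy)) /GRing.scale /= mulN1r mulNr.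
by rewrite expr2 invfM.
Qed.

(** Only a directional derivative of [f] is available, so the one-variable chain
    rule is applied on the line of direction [v]. *)
Lemma derivable_comp f (phi : R -> R) y v a :
  derivable f y v -> is_derive (f y : R) (1 : R) phi a ->
  derivable (phi \o f : _ -> R^o) y v /\ 'D_v (phi \o f : _ -> R^o) y = a * 'D_v f y.
Proof.
move=> df dphi.
pose g (h : R) : R := f (h *: v + y).
have dg : is_derive (0 : R) (1 : R) g ('D_v f y).
  have /derivable1P dg := df; apply: DeriveDef => //.
  rewrite /derive /g; congr (lim (_ @ 0^')); apply/funext => h /=.
  by rewrite addr0 scale0r add0r [_%:A]mulr1.
have g0 : g 0 = f y by rewrite /g scale0r add0r.
rewrite -g0 in dphi.
have [d1 d2] := is_derive1_comp dphi dg.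
split; first by apply/derivable1P.
rewrite -d2 /derive; congr (lim (_ @ 0^')); apply/funext => h /=.
by rewrite /g addr0 scale0r add0r [_%:A]mulr1.
Qed.

(** The induction on [k] is for all [m] at once: the derivative of [ln_quot m]
    involves [ln_quot m.+1]. *)
Lemma Ck_ln_quot k m U f : open U -> (forall y, U y -> 0 < f y) -> Ck k U f ->
  Ck k U (fun y => ln_quot m (f y)).
Proof.
move=> oU f0; elim: k m => [|k IH] m Cf; have [cf df] := Cf; split=> //.
1,2: move=> y Uy; have [d _] := is_derive_ln_quot m (f0 y Uy);
  apply: (@continuous_comp _ _ _ f (ln_quot m)); first exact: cf;
  exact/differentiable_continuous/derivable1_diffP.
move=> v; have [df1 df2] := df v.
have D y (Uy : U y) := derivable_comp (df1 y Uy)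
  (is_derive_ln_quot m (f0 y Uy)).
split; first by move=> y Uy; have [] := D y Uy.
have Cf' := Ck_pred Cf.
have C1 := Ck_mul oU (Ck_cst k U ((-1) ^+ m)) (Ck_inv oU f0 Cf').
have C2 := Ck_mul oU (Ck_cst k U (- m%:R)) (IH m.+1 Cf').
apply: Ck_ext oU _ (Ck_mul oU (Ck_add oU C1 C2) df2) => y Uy.
by have [_ ->] := D y Uy; rewrite mulNr.
Qed.

End CkAlgebra.

Section HalfSmooth.
Context {R : realType}.
Implicit Types (f g : 'rV[R]_3 -> R^o) (x : 'rV[R]_3).

Lemma half_smooth_ext f g x (V : set 'rV[R]_3) : open V -> V x ->
  (forall y, V y -> half_space y -> f y = g y) ->
  half_smooth_at f x -> half_smooth_at g x.
Proof.
move=> oV Vx fg [U [F [oU Ux CF fF]]]; exists (U `&` V), F; split=> //.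
- exact: openI.
- by move=> k; apply: Ck_sub (CF k) => y [].
- by move=> y [Uy Vy] hy; rewrite -fg // fF.
Qed.

Lemma half_smooth_cst (a : R) x : half_smooth_at (fun=> a) x.
Proof. by exists setT, (fun=> a); split=> //; [exact: openT|move=> k; exact: Ck_cst]. Qed.

Lemma half_smooth_op (op : R -> R -> R) f g x :
  (forall k U F G, open U -> Ck k U F -> Ck k U G ->
    Ck k U (fun y => op (F y) (G y) : R^o)) ->
  half_smooth_at f x -> half_smooth_at g x ->
  half_smooth_at (fun y => op (f y) (g y) : R^o) x.
Proof.
move=> H [U [F [oU Ux CF fF]]] [V [G [oV Vx CG gG]]].
exists (U `&` V), (fun y => op (F y) (G y)); split=> //; first exact: openI.
  by move=> k; apply: H; [exact: openI| |]; [apply: Ck_sub (CF k)|apply: Ck_sub (CG k)] => y [].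
by move=> y [Uy Vy] hy; rewrite fF // gG.
Qed.

(** The local extension of [f] need not be positive outside the half space: it is
    restricted to the open set where it is. *)
Lemma half_smooth_comp_pos (phi : R -> R) f x :
  (forall k U F, open U -> (forall y, U y -> 0 < F y) -> Ck k U F ->
    Ck k U (fun y => phi (F y) : R^o)) ->
  half_space x -> 0 < f x ->
  half_smooth_at f x -> half_smooth_at (fun y => phi (f y) : R^o) x.
Proof.
move=> H hx fx [U [F [oU Ux CF fF]]].
have Fx : 0 < F x by rewrite -fF.
pose V := [set y | U y /\ 0 < F y].
have oV : open V.
  rewrite openE => y [Uy Fy].
  apply: filterI; first exact: open_nbhs_nbhs.
  have cF : F @ y --> F y := Ck_cont (CF 0%N) Uy.
  exact: cvgr_gt cF _ Fy.
exists V, (fun y => phi (F y)); split=> //.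
  move=> k; apply: H => //; first by move=> y [].
  by apply: Ck_sub (CF k) => y [].
by move=> y [Uy _] hy; rewrite fF.
Qed.

Lemma half_smooth_cont f x : half_space x -> half_smooth_at f x ->
  f @ within half_space (nbhs x) --> f x.
Proof.
move=> hx [U [F [oU Ux CF fF]]]; rewrite (fF x) //.
have cF : F @ within half_space (nbhs x) --> F x.
  apply: cvg_within_filter.
  exact: Ck_cont (CF 0%N) Ux.
apply: cvg_trans cF; apply: near_eq_cvg; rewrite near_withinE.
by apply: filterS (open_nbhs_nbhs (conj oU Ux)) => y Uy hy; rewrite fF.
Qed.

End HalfSmooth.

(** * Smooth functions on the manifold *)
Lemma within_cvg (S T : topologicalType) (A : set S) (f : S -> T) x :
  {within A, continuous f} -> A x -> f @ within A (nbhs x) --> f x.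
Proof. by move=> /subspace_continuousP; exact. Qed.

Section SmoothFunctions.
Context {R : realType} {M : manifold R}.
Implicit Types (p q : M) (f g : M -> R) (c : chart R M).

Lemma cmap_half_space c p : cdom c p -> half_space (cmap c p).
Proof.
move=> cp; have [Q _ E] := cmap_image c.
have : (cmap c @` cdom c) (cmap c p) by exists p.
by rewrite E => -[].
Qed.

(** As charts are homeomorphisms onto relatively open subsets of the half space,
    a neighbourhood of a point becomes one in the model: this is how local
    equalities on the manifold are transported to charts. *)
Lemma chart_pullback c p (N : set M) : cdom c p -> nbhs p N ->
  exists V, [/\ open V, V (cmap c p) &
    forall y, V y -> half_space y -> N (cinv c y)].
Proof.
move=> cp Np; have [Q oQ E] := cmap_image c.
have Ap : (cmap c @` cdom c) (cmap c p) by exists p.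
have K : cinv c (cmap c p) = p by rewrite (cmapK (mem_set cp)).
have := within_cvg (cinv_continuous (c := c)) Ap; rewrite K => /(_ _ Np) H.
have {}H : \forall y \near cmap c p, (cmap c @` cdom c) y -> N (cinv c y) := H.
pose V := [set y | (cmap c @` cdom c) y -> N (cinv c y)]°.
have VN : V `<=` [set y | (cmap c @` cdom c) y -> N (cinv c y)] by exact: interior_subset.
have oV : open V by exact: open_interior.
have Vp : V (cmap c p) := H.
exists (V `&` Q); split; first exact: openI.
  by split=> //; move: Ap; rewrite E => -[].
by move=> y [Vy Qy] hy; apply: VN => //; rewrite E.
Qed.

Lemma cmap_cvg c p : cdom c p ->
  cmap c @ p --> within half_space (nbhs (cmap c p)).
Proof.
move=> cp A hA; have cA : \forall y \near cmap c p, half_space y -> A y := hA.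
have H := within_cvg (cmap_continuous (c := c)) cp cA.
have {H} : \forall q \near p, cdom c q -> half_space (cmap c q) -> A (cmap c q) := H.
apply: filterS2 (open_nbhs_nbhs (conj (cdom_open c) cp)) => q cq /(_ cq).
by apply; exact: cmap_half_space.
Qed.

Lemma smooth_near p f : smooth_at p f -> \forall q \near p, smooth_at q f.
Proof. exact: nbhs_interior. Qed.

Lemma smooth_cont p f : smooth_at p f -> {for p, continuous f}.
Proof.
move=> /nbhs_singleton sf; have [c ac cp] := atlas_cover p.
have K : cinv c (cmap c p) = p by rewrite (cmapK (mem_set cp)).
have := half_smooth_cont (cmap_half_space cp) (sf c ac cp).
rewrite /= K => cf; have := cvg_comp _ _ (cmap_cvg cp) cf.
change ((((f \o cinv c) \o cmap c) @ p --> f p) -> (f @ p --> f p)).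
apply: cvg_trans; apply: near_eq_cvg.
apply: filterS (open_nbhs_nbhs (conj (cdom_open c) cp)) => q cq.
by rewrite /= (cmapK (mem_set cq)).
Qed.

Lemma smooth_ext p f g : (\forall q \near p, f q = g q) ->
  smooth_at p f -> smooth_at p g.
Proof.
move=> /nbhs_interior fg sf; near=> q => c ac cq.
have fgq : nbhs q [set r | f r = g r] by near: q.
have [V [oV Vq VN]] := chart_pullback cq fgq.
apply: (half_smooth_ext oV Vq (f := f \o cinv c)); first by move=> y Vy hy; exact: VN.
by move: c ac cq {V oV Vq VN}; near: q.
Unshelve. all: by end_near. Qed.

Lemma smooth_op (op : R -> R -> R) p f g :
  (forall k (U : set 'rV[R]_3) F G, open U -> Ck k U F -> Ck k U G ->
    Ck k U (fun y => op (F y) (G y) : R^o)) ->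
  smooth_at p f -> smooth_at p g -> smooth_at p (fun q => op (f q) (g q)).
Proof.
move=> H; apply: filterS2 => q sf sg c ac cq.
exact: half_smooth_op H (sf c ac cq) (sg c ac cq).
Qed.

Lemma smooth_cst p (a : R) : smooth_at p (fun=> a).
Proof. by near=> q => c ac cq; exact: half_smooth_cst.
Unshelve. all: by end_near. Qed.

Lemma smooth_add p f g : smooth_at p f -> smooth_at p g ->
  smooth_at p (fun q => f q + g q).
Proof. by apply: (smooth_op (op := +%R)) => *; exact: Ck_add. Qed.

Lemma smooth_mul p f g : smooth_at p f -> smooth_at p g ->
  smooth_at p (fun q => f q * g q).
Proof. by apply: (smooth_op (op := *%R)) => *; exact: Ck_mul. Qed.

Lemma smooth_scale p a f : smooth_at p f -> smooth_at p (fun q => a * f q).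
Proof. by apply: smooth_mul; exact: smooth_cst. Qed.

Lemma smooth_opp p f : smooth_at p f -> smooth_at p (fun q => - f q).
Proof.
move=> /(smooth_scale (-1)); apply: smooth_ext; near=> q; exact: mulN1r.
Unshelve. all: by end_near. Qed.

Lemma smooth_sub p f g : smooth_at p f -> smooth_at p g ->
  smooth_at p (fun q => f q - g q).
Proof. by move=> sf sg; apply: smooth_add => //; exact: smooth_opp. Qed.

Lemma smooth_exp p f n : smooth_at p f -> smooth_at p (fun q => f q ^+ n).
Proof.
move=> sf; elim: n => [|n IH]; first exact: (smooth_cst p 1).
apply: smooth_ext (smooth_mul sf IH); near=> q; by rewrite exprS.
Unshelve. all: by end_near. Qed.

Lemma smooth_comp_pos (phi : R -> R) p f :
  (forall k (U : set 'rV[R]_3) F, open U -> (forall y, U y -> 0 < F y) ->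
    Ck k U F -> Ck k U (fun y => phi (F y) : R^o)) ->
  0 < f p -> smooth_at p f -> smooth_at p (fun q => phi (f q)).
Proof.
move=> H fp sf; have cf : f @ p --> f p := smooth_cont sf.
have near_pos : \forall q \near p, 0 < f q by exact: cvgr_gt cf _ fp.
near=> q => c ac cq; have fq : 0 < f q by near: q.
have sfq : forall c, atlas c -> cdom c q -> half_smooth_at (f \o cinv c) (cmap c q).
  by near: q.
apply: (half_smooth_comp_pos (f := f \o cinv c) H) => //.
- exact: cmap_half_space.
- by rewrite /= (cmapK (mem_set cq)).
- exact: sfq.
Unshelve. all: by end_near. Qed.

Lemma smooth_ln_quot m p f : 0 < f p -> smooth_at p f ->
  smooth_at p (fun q => ln_quot m (f q)).
Proof. by apply: smooth_comp_pos => *; exact: Ck_ln_quot. Qed.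

End SmoothFunctions.

(** * Tangent vectors and brackets *)
Section Derivations.
Context {R : realType} {M : manifold R}.
Implicit Types (p q : M) (f g : M -> R) (v w : vec M) (a : R).

Lemma tangent_local p v f g : tangent p v -> (\forall q \near p, f q = g q) ->
  v f = v g.
Proof. by case=> + _ _ _; exact. Qed.

Lemma tangent_zero p v : tangent p v -> v (fun=> 0) = 0.
Proof.
move=> [_ lin _ _]; have := lin (-1) _ _ (smooth_cst p 0) (smooth_cst p 0).
have -> : (fun=> -1 * 0 + 0) = (fun=> 0) :> (M -> R) by apply/funext => q; ring.
by rewrite mulN1r => ->; rewrite addNr.
Qed.

Lemma tangent_cst p v a : tangent p v -> v (fun=> a) = 0.
Proof.
move=> tv; have [_ lin leib _] := tv.
have v1 : v (fun=> 1) = 0.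
  have := leib _ _ (smooth_cst p 1) (smooth_cst p 1).
  by rewrite mulr1 !mul1r; lra.
have := lin a _ _ (smooth_cst p 1) (smooth_cst p 0).
by rewrite mulr1 addr0 v1 mulr0 (tangent_zero tv) add0r.
Qed.

Lemma tangentD p v f g : tangent p v -> smooth_at p f -> smooth_at p g ->
  v (fun q => f q + g q) = v f + v g.
Proof.
move=> [_ lin _ _] sf sg; have := lin 1 _ _ sf sg.
by rewrite mul1r => <-; congr v; apply/funext => q; rewrite mul1r.
Qed.

Lemma tangentM p v f g : tangent p v -> smooth_at p f -> smooth_at p g ->
  v (fun q => f q * g q) = f p * v g + g p * v f.
Proof. by case=> _ _ + _; exact. Qed.

Lemma tangentZ p v a f : tangent p v -> smooth_at p f ->
  v (fun q => a * f q) = a * v f.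
Proof.
move=> tv sf; rewrite (tangentM tv (smooth_cst p a) sf).
by rewrite (tangent_cst a tv) mulr0 addr0.
Qed.

Lemma tangentN p v f : tangent p v -> smooth_at p f -> v (fun q => - f q) = - v f.
Proof.
move=> tv sf; rewrite -mulN1r -(tangentZ _ tv sf); congr v; apply/funext => q.
by rewrite mulN1r.
Qed.

Lemma tangentB p v f g : tangent p v -> smooth_at p f -> smooth_at p g ->
  v (fun q => f q - g q) = v f - v g.
Proof.
by move=> tv sf sg; rewrite (tangentD tv sf (smooth_opp sg)) (tangentN tv sg).
Qed.

(** Up to a constant, [f p = 1]; then [ln f = (f - 1) * ln_quot 1 f] with the first
    factor vanishing at [p] and the second equal to 1 there, so that the Leibniz
    rule leaves [v f]. *)
Lemma tangent_ln p v f : tangent p v -> 0 < f p -> smooth_at p f ->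
  v (fun q => ln (f q)) = v f / f p.
Proof.
move=> tv fp sf; have fn0 : f p != 0 by rewrite gt_eqF.
pose g q := (f p)^-1 * f q; have sg : smooth_at p g := smooth_scale _ sf.
have gp : g p = 1 by rewrite /g mulVf.
have gp0 : 0 < g p by rewrite gp.
have sl : smooth_at p (fun q => ln (g q)) := smooth_ln_quot 0 gp0 sg.
have E : v (fun q => ln (g q)) = v g.
  have -> : (fun q => ln (g q)) = (fun q => (g q - 1) * ln_quot 1 (g q)).
    apply/funext => q; rewrite -[ln _]/(ln_quot 0 (g q)) ln_quotS.
    by rewrite /ln_coef invr0 mulr0 add0r.
  rewrite (tangentM tv (smooth_sub sg (smooth_cst p 1)) (smooth_ln_quot 1 gp0 sg)).
  rewrite gp subrr mul0r add0r ln_quot1 /ln_coef expr1 opprK divr1 mul1r.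
  by rewrite (tangentB tv sg (smooth_cst p 1)) (tangent_cst _ tv) subr0.
have -> : v (fun q => ln (f q)) = v (fun q => ln (f p) + ln (g q)).
  apply: (tangent_local tv).
  have cf : f @ p --> f p := smooth_cont sf.
  apply: filterS (cvgr_gt _ cf _ fp) => q fq.
  by rewrite -lnM ?posrE ?divr_gt0 ?mulr_gt0 ?invr_gt0 // /g mulVKf.
rewrite (tangentD tv (smooth_cst p _) sl) (tangent_cst _ tv) add0r E.
by rewrite (tangentZ _ tv sf) mulrC.
Qed.

Lemma tangent_lin p a v w : tangent p v -> tangent p w -> tangent p (a *: v + w).
Proof.
have E f : (a *: v + w) f = a * v f + w f by [].
move=> [v1 v2 v3 v4] [w1 w2 w3 w4]; split.
- by move=> f g fg; rewrite !E (v1 _ _ fg) (w1 _ _ fg).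
- by move=> b f g sf sg; rewrite !E (v2 _ _ _ sf sg) (w2 _ _ _ sf sg); ring.
- by move=> f g sf sg; rewrite !E (v3 _ _ sf sg) (w3 _ _ sf sg); ring.
- by move=> f nf; rewrite !E (v4 _ nf) (w4 _ nf); ring.
Qed.

Lemma tangent0 p : tangent p 0.
Proof.
have E f : (0 : vec M) f = 0 by [].
by split=> *; rewrite !E ?mulr0 ?addr0.
Qed.

Lemma tangent_scale p a v : tangent p v -> tangent p (a *: v).
Proof. by move=> tv; rewrite -[_ *: _]addr0; apply: tangent_lin => //; exact: tangent0. Qed.

Lemma tangent_opp p v : tangent p v -> tangent p (- v).
Proof. by rewrite -scaleN1r; exact: tangent_scale. Qed.

End Derivations.

Section Fields.
Context {R : realType} {M : manifold R}.
Implicit Types (U : set M) (X Y : vf M) (f g : M -> R).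

Lemma vfield_smooth U X p f : vfield U X -> U p -> smooth_at p f ->
  smooth_at p (apply_vf X f).
Proof. by case=> _ + Up; exact. Qed.

Lemma vfield_zero U : vfield U (fun=> 0 : vec M).
Proof. by split=> [p _|p f _ _]; [exact: tangent0|exact: smooth_cst]. Qed.

Lemma vfield_opp U X : vfield U X -> vfield U (fun p => - X p).
Proof.
move=> [tX sX]; split=> [p Up|p f Up sf]; first exact/tangent_opp/tX.
exact: smooth_opp (sX p f Up sf).
Qed.

Lemma bracketE X Y p f : smooth_at p f ->
  bracket X Y p f = X p (apply_vf Y f) - Y p (apply_vf X f).
Proof. by move=> sf; rewrite /bracket; case: asboolP. Qed.

Lemma vfield_bracket U X Y : open U -> vfield U X -> vfield U Y ->
  vfield U (bracket X Y).
Proof.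
move=> oU vX vY; have [tX sX] := vX; have [tY sY] := vY; split=> [p Up|p f Up sf].
  have nU := open_nbhs_nbhs (conj oU Up).
  have near_apply Z (vZ : vfield U Z) f g : (\forall q \near p, f q = g q) ->
      \forall q \near p, apply_vf Z f q = apply_vf Z g q.
    move=> /nbhs_interior fg; apply: filterS2 fg nU => q fg Uq.
    exact: tangent_local (vZ.1 q Uq) fg.
  split.
  - move=> f g fg; rewrite /bracket.
    have gf : \forall q \near p, g q = f q by apply: filterS fg.
    have -> : `[< smooth_at p f >] = `[< smooth_at p g >].
      by apply/asbool_equiv_eq; split; exact: smooth_ext.
    case: ifP => // _; congr (_ - _).
      exact: tangent_local (tX p Up) (near_apply Y vY _ _ fg).
    exact: tangent_local (tY p Up) (near_apply X vX _ _ fg).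
  - move=> a f g sf sg.
    have nlin Z (vZ : vfield U Z) :
        \forall q \near p, apply_vf Z (fun q => a * f q + g q) q =
          a * apply_vf Z f q + apply_vf Z g q.
      have nsf := smooth_near sf; have nsg := smooth_near sg.
      near=> q; have Uq : U q by near: q.
      by have [_ + _ _] := vZ.1 q Uq; apply; near: q.
    rewrite !bracketE ?(tangent_local (tX p Up) (nlin Y vY))
      ?(tangent_local (tY p Up) (nlin X vX)) //; last first.
      exact: smooth_add (smooth_scale a sf) sg.
    have [_ lX _ _] := tX p Up; have [_ lY _ _] := tY p Up.
    rewrite (lX a _ _ (sY p f Up sf) (sY p g Up sg)).
    by rewrite (lY a _ _ (sX p f Up sf) (sX p g Up sg)); rewrite /apply_vf; ring.
  - move=> f g sf sg.
    have nmul Z (vZ : vfield U Z) :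
        \forall q \near p, apply_vf Z (fun q => f q * g q) q =
          f q * apply_vf Z g q + g q * apply_vf Z f q.
      have nsf := smooth_near sf; have nsg := smooth_near sg.
      near=> q; have Uq : U q by near: q.
      by have [_ _ + _] := vZ.1 q Uq; apply; near: q.
    rewrite !bracketE ?(tangent_local (tX p Up) (nmul Y vY))
      ?(tangent_local (tY p Up) (nmul X vX)) //; last exact: smooth_mul.
    have sXf : smooth_at p (apply_vf X f) := sX p f Up sf.
    have sXg : smooth_at p (apply_vf X g) := sX p g Up sg.
    have sYf : smooth_at p (apply_vf Y f) := sY p f Up sf.
    have sYg : smooth_at p (apply_vf Y g) := sY p g Up sg.
    rewrite (tangentD (tX p Up) (smooth_mul sf sYg) (smooth_mul sg sYf)).
    rewrite (tangentD (tY p Up) (smooth_mul sf sXg) (smooth_mul sg sXf)).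
    rewrite (tangentM (tX p Up) sf sYg) (tangentM (tX p Up) sg sYf).
    rewrite (tangentM (tY p Up) sf sXg) (tangentM (tY p Up) sg sXf).
    by rewrite /apply_vf; ring.
  - by move=> f nf; rewrite /bracket; case: asboolP.
have sXYf : smooth_at p (apply_vf X (apply_vf Y f)) by apply: (sX _ _ Up); exact: (sY p).
have sYXf : smooth_at p (apply_vf Y (apply_vf X f)) by apply: (sY _ _ Up); exact: (sX p).
apply: smooth_ext (smooth_sub sXYf sYXf).
by apply: filterS (smooth_near sf) => q sq; rewrite bracketE.
Unshelve. all: by end_near. Qed.

End Fields.

(** * Functions along a curve with given velocity *)
Section Velocity.
Context {R : realType} {M : manifold R}.
Implicit Types (f : M -> R) (v : vec M) (gam : R -> M).

Lemma velocity_ball gam (d s : R) v f : velocity gam d s v -> smooth_at (gam s) f ->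
  forall e, 0 < e -> exists2 r, 0 < r & forall t, `|t - s| < r -> t != s ->
    0 <= t < d -> `|v f - (t - s)^-1 * (f (gam t) - f (gam s))| < e.
Proof.
move=> vel sf e e0; have /cvgrPdist_lt/(_ e e0) := vel f sf.
rewrite /within /= => /nbhs_ballP[r r0 H]; exists r => // t ts tn td.
by apply: H => //; rewrite /ball /= distrC.
Qed.

Lemma velocity_derive gam (d s : R) v f : velocity gam d s v ->
  smooth_at (gam s) f -> 0 < s < d -> is_derive s 1 (fun t => f (gam t)) (v f).
Proof.
move=> vel sf /andP[s0 sd].
have dq : (fun h : R => h^-1 *: (f (gam (h *: 1 + s)) - f (gam s))) @ 0^' --> v f.
  apply/cvgrPdist_lt => e e0; have [r r0 H] := velocity_ball vel sf e0.
  near=> h; have -> : h *: 1 + s = h + s :> R by rewrite /GRing.scale /= mulr1.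
  have hn0 : h != 0 by near: h; exact: nbhs_dnbhs_neq.
  have hs : `|h| < Num.min r (Num.min s (d - s)).
    near: h; apply: dnbhs0_lt; rewrite !lt_min r0 s0 /=; lra.
  have := hs; rewrite !lt_min => /and3P[h1 h2 h3].
  have := H (h + s); rewrite addrK; apply=> //.
    by rewrite -subr_eq0 addrK.
  by move: h2 h3; rewrite !ltr_norml => /andP[a b] /andP[a' b']; lra.
apply: DeriveDef; first by apply/cvg_ex; exists (v f).
exact: cvg_lim dq.
Unshelve. all: by end_near. Qed.

Lemma velocity_right gam (d : R) v f : velocity gam d 0 v ->
  smooth_at (gam 0) f -> 0 < d ->
  (f (gam t) - f (gam 0)) / t @[t --> 0^'+] --> (v f : R).
Proof.
move=> vel sf d0; apply/cvgrPdist_lt => e e0.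
have [r r0 H] := velocity_ball vel sf e0.
near=> t; have t0 : 0 < t by [].
have tr : t < r by near: t; exact: nbhs_right_lt.
have td : t < d by near: t; exact: nbhs_right_lt.
have := H t; rewrite subr0 mulrC; apply; rewrite ?gtr0_norm ?gt_eqF //.
by rewrite ltW.
Unshelve. all: by end_near. Qed.

Lemma velocity_right_cont gam (d : R) v f : velocity gam d 0 v ->
  smooth_at (gam 0) f -> 0 < d -> f (gam t) @[t --> 0^'+] --> f (gam 0).
Proof.
move=> vel sf d0.
have id0 : (fun t : R => t) @ 0^'+ --> (0 : R) by apply: cvg_within_filter; exact: cvg_id.
have : f (gam 0) + t * ((f (gam t) - f (gam 0)) / t) @[t --> 0^'+] --> f (gam 0) + 0 * (v f : R).
  by apply: cvgD; [exact: cvg_cst|apply: cvgM id0 (velocity_right vel sf d0)].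
rewrite mul0r addr0; apply: cvg_trans; apply: near_eq_cvg.
near=> t; have t0 : t != 0 by rewrite gt_eqF.
by field.
Unshelve. all: by end_near. Qed.

(** A function killed by the velocity field of a curve is constant along it: at
    the initial time, where the derivative is one-sided, continuity is enough
    for the mean value theorem. *)
Lemma velocity_const gam (d : R) (E : vf M) f :
  (forall t, 0 <= t < d -> velocity gam d t (E (gam t))) ->
  (forall t, 0 <= t < d -> smooth_at (gam t) f) ->
  (forall t, 0 <= t < d -> E (gam t) f = 0) ->
  forall s, 0 <= s < d -> f (gam s) = f (gam 0).
Proof.
move=> vel sf E0 s /andP[]; rewrite le_eqVlt => /predU1P[<- //|s0] sd.
have d0 : 0 <= (0 : R) < d by rewrite lexx (lt_trans s0).
have D t : 0 < t < d -> is_derive t 1 (fun t => f (gam t)) 0.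
  move=> td; have td' : 0 <= t < d by case/andP: td => t0 ->; rewrite ltW.
  by rewrite -(E0 t td'); exact: velocity_derive (vel t td') (sf t td') td.
have C t : 0 < t < d -> {for t, continuous (fun t => f (gam t))}.
  by move=> /D[dt _]; exact/differentiable_continuous/derivable1_diffP.
have [t||t _ /eqP] := @MVT R (fun t => f (gam t)) (fun=> 0) 0 s s0.
- by rewrite in_itv /= => ts; apply: D; lra.
- apply/(continuous_within_itvP _ s0); split.
  + by move=> t; rewrite in_itv /= => ts; apply: C; lra.
  + by apply: velocity_right_cont (vel 0 d0) (sf 0 d0) _; lra.
  + by apply: cvg_within_filter; apply: C; lra.
- by rewrite mul0r subr_eq0 => /eqP.
Qed.

End Velocity.

(** * The frame on the geodesic collar *)
Section Forms.
Context {R : realType} {M : manifold R}.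
Implicit Types (U W : set M) (X Y : vf M) (p : M).

Lemma vfield_sub U W X : W `<=` U -> vfield U X -> vfield W X.
Proof. by move=> WU [tX sX]; split=> [p /WU|p f /WU]; [exact: tX|exact: sX]. Qed.

Lemma oneform0 W (th : form1 M) p : oneform W th -> W p -> th p 0 = 0.
Proof.
move=> [lin _] Wp; have t0 := @tangent0 R M p.
by have := lin p (-1) 0 0 Wp t0 t0; rewrite scaler0 addr0; lra.
Qed.

Lemma oneformD W (th : form1 M) p v w : oneform W th -> W p ->
  tangent p v -> tangent p w -> th p (v + w) = th p v + th p w.
Proof.
by move=> [lin _] Wp tv tw; have := lin p 1 v w Wp tv tw; rewrite scale1r mul1r.
Qed.

Lemma oneformZ W (th : form1 M) p a v : oneform W th -> W p -> tangent p v ->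
  th p (a *: v) = a * th p v.
Proof.
move=> oth Wp tv; have := oth.1 p a v 0 Wp tv (@tangent0 _ _ p).
by rewrite addr0 (oneform0 oth Wp) addr0.
Qed.

Lemma oneformN W (th : form1 M) p v : oneform W th -> W p -> tangent p v ->
  th p (- v) = - th p v.
Proof. by move=> oth Wp tv; rewrite -scaleN1r (oneformZ _ oth Wp tv) mulN1r. Qed.

Lemma oneform_smooth U (th : form1 M) X : open U -> oneform U th -> vfield U X ->
  smooth_on U (fun q => th q (X q)).
Proof. by move=> oU [_ s] vX; exact: s. Qed.

Lemma bracket_zero_r X p : tangent p (X p) -> bracket X (fun=> 0) p = 0.
Proof.
move=> tX; apply/funext => f; rewrite /bracket; case: asboolP => // _.
by rewrite -[apply_vf _ f]/(fun=> 0) (tangent_zero tX) subr0.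
Qed.

Lemma bracket_zero_l X p : tangent p (X p) -> bracket (fun=> 0) X p = 0.
Proof.
move=> tX; apply/funext => f; rewrite /bracket; case: asboolP => // _.
by rewrite -[apply_vf (fun=> 0) f]/(fun=> 0) (tangent_zero tX) subr0.
Qed.

End Forms.

Section Pseudohermitian.
Context {R : realType} {M : manifold R} (P : pseudohermitian M).
Implicit Types (U W : set M) (X Y : vf M) (p : M) (v : vec M).

Let thetaT : oneform setT (theta P) := theta_form P.

Lemma theta_smooth U X : open U -> vfield U X ->
  smooth_on U (fun q => theta P q (X q)).
Proof. by move=> oU vX; apply: thetaT.2. Qed.

Lemma theta0 p : theta P p 0 = 0.
Proof. exact: oneform0 thetaT I. Qed.

Lemma thetaN p v : tangent p v -> theta P p (- v) = - theta P p v.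
Proof. exact: oneformN thetaT I. Qed.

Lemma xi0 p : xi P p 0.
Proof. by split; [exact: tangent0|exact: theta0]. Qed.

Lemma J0 p : J P p 0 = 0.
Proof.
have := J_linear 1 (xi0 p) (xi0 p); rewrite !scale1r addr0 => /eqP.
by rewrite -subr_eq0 opprD addNKr oppr_eq0 => /eqP.
Qed.

Lemma JN p v : xi P p v -> J P p (- v) = - J P p v.
Proof.
move=> xv; have := J_linear (-1) xv (xi0 p).
by rewrite addr0 J0 addr0 !scaleN1r.
Qed.

Lemma dtheta_zero_r U X p : open U -> U p -> vfield U X ->
  dtheta P p (X p) 0 = 0.
Proof.
move=> oU Up vX; rewrite -[0 in LHS]/((fun=> 0 : vec M) p).
rewrite (dthetaE P oU vX (@vfield_zero _ _ U) Up) /d1.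
have tX := vX.1 p Up.
have -> : (fun q => theta P q 0) = (fun=> 0) by apply/funext => q; exact: theta0.
by rewrite (tangent_zero tX) (bracket_zero_r tX) theta0 -[X in _ - X - _]/(0 : R) !subr0.
Qed.

Lemma dtheta_zero_l U X p : open U -> U p -> vfield U X ->
  dtheta P p 0 (X p) = 0.
Proof.
move=> oU Up vX; rewrite -[0 in LHS]/((fun=> 0 : vec M) p).
rewrite (dthetaE P oU (@vfield_zero _ _ U) vX Up) /d1.
have tX := vX.1 p Up.
have -> : (fun q => theta P q 0) = (fun=> 0) by apply/funext => q; exact: theta0.
by rewrite (tangent_zero tX) (bracket_zero_l tX) theta0 -[X in X - _ - _]/(0 : R) !subr0.
Qed.

(** The terms [X theta(Y)] and [Y theta(X)] of the exterior derivative are derivatives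
    of functions that vanish near [p]. *)
Lemma dtheta_xi U X Y p : open U -> U p -> section_xi P U X -> section_xi P U Y ->
  dtheta P p (X p) (Y p) = - theta P p (bracket X Y p).
Proof.
move=> oU Up [vX xX] [vY xY]; rewrite (dthetaE P oU vX vY Up) /d1.
have Z Z1 Z2 : vfield U Z1 -> (forall q, U q -> xi P q (Z2 q)) ->
    Z1 p (fun q => theta P q (Z2 q)) = 0.
  move=> v1 x2; rewrite -(tangent_zero (v1.1 p Up)).
  apply: (tangent_local (v1.1 p Up)).
  by apply: filterS (open_nbhs_nbhs (conj oU Up)) => q Uq; have [] := x2 q Uq.
by rewrite (Z X Y) // (Z Y X) // subrr sub0r.
Qed.

End Pseudohermitian.

Section Collar.
Context {R : realType} {M : manifold R} (P : pseudohermitian M).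
Context (nab : covd M) (hnab : tanaka_webster P nab).
Context (U : set M) (delta : M -> R) (ex : M -> R -> M) (foot : M -> M).
Context (rho : M -> R) (e1 e2 : vf M).
Context (hU : geodesic_collar P nab U delta ex foot rho e1 e2).
Implicit Types (p q x : M) (s : R) (f : M -> R).

Let oU : open U := collar_open hU.
Let ve2 : vfield U e2 := collar_e2 hU.

Lemma collar_near p : U p -> \forall q \near p, U q.
Proof. by move=> Up; exact: open_nbhs_nbhs. Qed.

Lemma collar_rho0 x : boundary M x -> U x -> rho x = 0.
Proof.
move=> bx Ux; have [d0 E] := collar_ex0 hU bx Ux.
have [|_ _] := collar_exK hU bx Ux (s := 0); first by rewrite lexx.
by rewrite E.
Qed.

Lemma collar_foot_id x : boundary M x -> U x -> foot x = x.
Proof.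
move=> bx Ux; have [d0 E] := collar_ex0 hU bx Ux.
have [|_ + _] := collar_exK hU bx Ux (s := 0); first by rewrite lexx.
by rewrite E.
Qed.

(** The geodesics of the collar are integral curves of [e2] and start at the foot. *)
Lemma collar_const f : smooth_on U f -> (forall p, U p -> e2 p f = 0) ->
  forall p, U p -> f p = f (foot p).
Proof.
move=> sf E0 p Up; have [bx Ux s_delta Ep] := collar_footK hU Up.
have [d0 Ex0] := collar_ex0 hU bx Ux.
rewrite -{1}Ep (velocity_const (E := e2) (d := delta (foot p))) ?Ex0 //.
- by move=> t ht; exact: collar_velocity hU _ _ bx Ux ht.
- by move=> t ht; apply: sf; have [] := collar_exK hU bx Ux ht.
- by move=> t ht; apply: E0; have [] := collar_exK hU bx Ux ht.
Qed.

Lemma collar_e2_parallel p : U p -> nab p (e2 p) e2 = 0.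
Proof.
move=> Up; have [bx Ux s_delta Ep] := collar_footK hU Up.
rewrite -Ep; apply: (collar_geodesic hU bx Ux s_delta oU _ ve2); rewrite ?Ep //.
by move=> t ht _; exact: collar_velocity hU _ _ bx Ux ht.
Qed.

Let te2 p : U p -> tangent p (e2 p). Proof. exact: ve2.1. Qed.

(** [theta] evaluated on [e2] is [metric e2 T], where [T] is parallel and [e2] is
    parallel in its own direction; it is therefore constant along the geodesics,
    and it vanishes on the boundary. *)
Lemma collar_xi_e2 : section_xi P U e2.
Proof.
split=> // p Up; split; first exact: te2.
pose f q := theta P q (e2 q).
have sf : smooth_on U f by exact: theta_smooth.
have [bx Ux _ _] := collar_footK hU Up.
have -> : theta P p (e2 p) = f (foot p).
  apply: (collar_const sf) => // q Uq.
  have vT : vfield U (reeb P) by apply: vfield_sub (reeb_field P).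
  have E : \forall r \near q, f r = metric P r (e2 r) (reeb P r).
    apply: filterS (collar_near Uq) => r Ur.
    rewrite /metric reeb_theta scale1r subrr J0 (dtheta_zero_r P oU Ur ve2).
    by rewrite mulr1 mulr0 addr0.
  rewrite (tangent_local (te2 Uq) E).
  rewrite (tw_metric hnab oU Uq (te2 Uq) ve2 vT) (collar_e2_parallel Uq).
  rewrite (tw_reeb hnab (te2 Uq)) /metric theta0 reeb_theta scale0r scale1r !subrr J0.
  have -> : dtheta P q 0 0 = 0 by exact: (dtheta_zero_l P oU Uq (vfield_zero U)).
  rewrite (dtheta_zero_r P oU Uq ve2); ring.
rewrite /f (collar_e2_J hU bx Ux).
have [_ xe1 _] := collar_e1_unit hU bx Ux.
by have [] := J_plane xe1.
Qed.

Let xe2 p : U p -> xi P p (e2 p). Proof. exact: collar_xi_e2.2. Qed.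

Lemma collar_xi_e1 : section_xi P U e1.
Proof.
have vJ : vfield U (fun p => - J P p (e2 p)).
  by apply: vfield_opp; apply: (J_smooth oU ve2); exact: collar_xi_e2.2.
have E q : U q -> e1 q = - J P q (e2 q) by exact: collar_e1 hU _.
split; last first.
  move=> p Up; have [tJ thJ] := J_plane (xe2 Up).
  by rewrite (E p Up); split; [exact: tangent_opp|rewrite (thetaN _ tJ) thJ oppr0].
split=> [p Up|p f Up sf]; first by rewrite (E p Up); exact: vJ.1.
apply: smooth_ext (vJ.2 p f Up sf).
by apply: filterS (collar_near Up) => q Uq; rewrite (E q Uq).
Qed.

Let ve1 : vfield U e1 := collar_xi_e1.1.
Let te1 p : U p -> tangent p (e1 p). Proof. exact: ve1.1. Qed.

Lemma collar_J_e1 p : U p -> J P p (e1 p) = e2 p.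
Proof.
move=> Up; have xJ := J_plane (xe2 Up).
by rewrite (collar_e1 hU Up) (JN xJ) (J_square (xe2 Up)) opprK.
Qed.

(* The common value of [metric e1 e1] and [metric e2 e2], in a form that is
   visibly smooth. *)
Let half_dtheta p : R := - (2^-1 * theta P p (bracket e1 e2 p)).

Lemma metric_e1 p : U p -> metric P p (e1 p) (e1 p) = half_dtheta p.
Proof.
move=> Up; rewrite /metric; have [_ ->] := collar_xi_e1.2 p Up.
rewrite scale0r subr0 (collar_J_e1 Up).
by rewrite (dtheta_xi oU Up collar_xi_e1 collar_xi_e2) mul0r add0r mulrN.
Qed.

Lemma metric_e2 p : U p -> metric P p (e2 p) (e2 p) = half_dtheta p.
Proof.
move=> Up; rewrite /metric; have [_ ->] := xe2 Up.
rewrite scale0r subr0.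
have -> : J P p (e2 p) = - e1 p by rewrite (collar_e1 hU Up) opprK.
have vN : section_xi P U (fun q => - e1 q).
  split; first exact: vfield_opp.
  move=> q Uq; have [t1 th1] := collar_xi_e1.2 q Uq.
  by split; [exact: tangent_opp|rewrite (thetaN _ t1) th1 oppr0].
rewrite (dtheta_xi oU Up collar_xi_e2 vN) mul0r add0r mulrN /half_dtheta.
suff -> : bracket e2 (fun q => - e1 q) p = bracket e1 e2 p by [].
apply/funext => f; rewrite /bracket; case: asboolP => // sf.
rewrite -[apply_vf (fun q => - e1 q) f]/(fun q => - apply_vf e1 f q).
rewrite (tangentN (te2 Up) (vfield_smooth ve1 Up sf)).
by rewrite -[(- e1 p) _]/(- (e1 p (apply_vf e2 f))) opprK addrC.
Qed.

(** [e2] is parallel in its own direction, so its norm is constant along the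
    geodesics; it is 1 on the boundary. *)
Lemma collar_metric_e1 p : U p -> metric P p (e1 p) (e1 p) = 1.
Proof.
move=> Up; rewrite metric_e1 //; have [bx Ux _ _] := collar_footK hU Up.
have vb := vfield_bracket oU ve1 ve2.
have sm : smooth_on U half_dtheta.
  by move=> q Uq; apply/smooth_opp/smooth_scale; exact: theta_smooth oU vb q Uq.
rewrite (collar_const sm) //.
  by rewrite -metric_e1 //; have [] := collar_e1_unit hU bx Ux.
move=> q Uq.
have E : \forall r \near q, half_dtheta r = metric P r (e2 r) (e2 r).
  by apply: filterS (collar_near Uq) => r Ur; rewrite metric_e2.
rewrite (tangent_local (te2 Uq) E) (tw_metric hnab oU Uq (te2 Uq) ve2 ve2).
rewrite (collar_e2_parallel Uq) /metric theta0 scale0r subrr J0.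
have [_ ->] := xe2 Uq; rewrite scale0r subr0 (dtheta_zero_r P oU Uq ve2).
have xJ : vfield U (fun p => J P p (e2 p)) by apply: (J_smooth oU ve2); exact: collar_xi_e2.2.
rewrite (dtheta_zero_l P oU Uq xJ); ring.
Qed.

Lemma collar_frame : orthonormal_frame P U e1 e2.
Proof.
split; [exact: collar_xi_e1|exact: collar_xi_e2|exact: collar_metric_e1|].
by move=> p Up; rewrite collar_J_e1.
Qed.

Lemma collar_dtheta p : U p -> dtheta P p (e1 p) (e2 p) = 2.
Proof.
move=> Up; have := collar_metric_e1 Up; rewrite metric_e1 // /half_dtheta.
rewrite (dtheta_xi oU Up collar_xi_e1 collar_xi_e2); lra.
Qed.

Context (om : form1 M) (hom : connection_form nab U e1 e2 om).

(** The geodesic equation is [0 = nab e2 e2 = - om(e2) e1], with [e1] of norm 1. *)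
Lemma collar_om_e2 p : U p -> om p (e2 p) = 0.
Proof.
move=> Up; have [_ E] := hom.2 p (e2 p) Up (te2 Up).
rewrite (collar_e2_parallel Up) in E.
have [//|o0] := eqVneq (om p (e2 p)) 0.
have e10 : e1 p = 0.
  move/esym/eqP: E; rewrite scaler_eq0 oppr_eq0 (negbTE o0) /=.
  by move/eqP.
have := collar_metric_e1 Up; rewrite e10 /metric theta0 scale0r subrr J0.
rewrite (dtheta_zero_l P oU Up (vfield_zero U)); lra.
Qed.

Let tT p : tangent p (reeb P p). Proof. exact: (reeb_field P).1. Qed.

(** The bracket is the antisymmetrized covariant derivative minus the torsion, which
    is [dtheta(e1, e2) T = 2 T]. *)
Lemma collar_bracket p : U p ->
  bracket e1 e2 p = - om p (e1 p) *: e1 p - 2 *: reeb P p.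
Proof.
move=> Up; have := tw_torsion_plane hnab oU Up collar_xi_e1 collar_xi_e2.
rewrite (collar_dtheta Up) /torsion.
have [_ ->] := hom.2 p (e1 p) Up (te1 Up).
have [-> _] := hom.2 p (e2 p) Up (te2 Up).
rewrite (collar_om_e2 Up) scale0r subr0 => <-.
by rewrite opprB addrC subrK.
Qed.

Context (a1 a2 : M -> R) (ha : torsion_coefficients P nab U e1 e2 a1 a2).

(** [T] is parallel, so that [nab T e1 = om(T) e2] is the only covariant derivative
    left. *)
Lemma collar_bracket_reeb p : U p ->
  bracket (reeb P) e1 p =
    om p (reeb P p) *: e2 p - (a1 p *: e1 p - a2 p *: e2 p).
Proof.
move=> Up; have [<- _] := ha Up.
have [<- _] := hom.2 p (reeb P p) Up (tT p).
rewrite /torsion (tw_reeb hnab (te1 Up)) subr0.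
by rewrite opprB addrC subrK.
Qed.

Context (W : M -> R) (hW : webster_curvature P nab W).

(** The definition of [W] reads
    [- 2 W = e1 (om e2) - e2 (om e1) - om [e1, e2]], where [om e2 = 0]. *)
Lemma collar_curvature p : U p ->
  e2 p (fun q => om q (e1 q)) = om p (e1 p) ^+ 2 + 2 * om p (reeb P p) + 2 * W p.
Proof.
move=> Up; have := hW oU collar_frame hom Up; rewrite /d1.
have -> : e1 p (fun q => om q (e2 q)) = 0.
  rewrite -(tangent_zero (te1 Up)); apply: (tangent_local (te1 Up)).
  by apply: filterS (collar_near Up) => q; exact: collar_om_e2.
have ho := hom.1.
rewrite (collar_bracket Up) (oneformD ho Up); last 2 first.
- by apply: tangent_scale; exact: te1.
- by apply/tangent_opp/tangent_scale/tT.
rewrite (oneformN ho Up (tangent_scale _ (tT p))).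
rewrite (oneformZ _ ho Up (te1 Up)) (oneformZ _ ho Up (tT p)).
set b := e2 p _; rewrite expr2; lra.
Qed.

End Collar.

(** * First order behaviour of the derivatives of rho at the boundary *)
Section RhoDerivatives.
Context {R : realType} {M : manifold R} (P : pseudohermitian M).
Context (nab : covd M) (hnab : tanaka_webster P nab).
Context (U : set M) (delta : M -> R) (ex : M -> R -> M) (foot : M -> M).
Context (rho : M -> R) (e1 e2 : vf M).
Context (hU : geodesic_collar P nab U delta ex foot rho e1 e2).
Context (om : form1 M) (hom : connection_form nab U e1 e2 om).
Implicit Types (p q x : M) (s : R) (f : M -> R).

Let ve1 : vfield U e1 := (collar_xi_e1 hnab hU).1.
Let te1 p (Up : U p) : tangent p (e1 p) := ve1.1 p Up.
Let srho : smooth_on U rho := collar_rho_smooth hU.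

(** Along a geodesic [rho] is the parameter, so all difference quotients in the
    definition of the velocity are equal to 1; this includes those at parameter 0,
    which are one-sided. *)
Lemma collar_e2_rho p : U p -> e2 p rho = 1.
Proof.
move=> Up; have [bx Ux sd Ep] := collar_footK hU Up.
have vel := collar_velocity hU bx Ux sd.
have sr : smooth_at (ex (foot p) (rho p)) rho by rewrite Ep; exact: srho.
apply/eqP; rewrite -subr_eq0 -normr_eq0 eq_le normr_ge0 andbT.
apply/ler_addgt0Pl => e e0; rewrite addr0.
have [r r0 H] := velocity_ball vel sr e0.
set s := rho p in sd H *; set d := delta _ in sd H *.
have [t [ts tr td]] : exists t : R, [/\ s < t, t - s < r & t < d].
  exists (s + Num.min r (d - s) / 2).
  have m0 : 0 < Num.min r (d - s) by rewrite lt_min r0 subr_gt0; case/andP: sd.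
  have m1 : Num.min r (d - s) <= r by rewrite ge_min lexx.
  have m2 : Num.min r (d - s) <= d - s by rewrite ge_min lexx orbT.
  by split; lra.
have td' : 0 <= t < d by case/andP: sd => s0 _; rewrite td (ltW (le_lt_trans s0 ts)).
have := H t; rewrite gtr0_norm ?subr_gt0 // => /(_ tr).
have [_ _ ->] := collar_exK hU bx Ux td'.
have [_ _ ->] := collar_exK hU bx Ux sd.
rewrite mulVf ?subr_eq0 ?gt_eqF // Ep => L; apply/ltW/L => //.
Qed.

(** [[e1, e2]] applied to [rho]; [e2 rho] is constant. *)
Lemma collar_e2_e1_rho p : U p ->
  e2 p (apply_vf e1 rho) = om p (e1 p) * e1 p rho + 2 * reeb P p rho.
Proof.
move=> Up; have sr := srho Up.
have := congr1 (fun v : vec M => v rho) (collar_bracket hnab hU hom Up).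
rewrite /= bracketE //.
have -> : e1 p (apply_vf e2 rho) = 0.
  rewrite -(tangent_cst 1 (te1 Up)); apply: (tangent_local (te1 Up)).
  by apply: filterS (collar_near hU Up) => q; exact: collar_e2_rho.
rewrite -[RHS]/(- om p (e1 p) * e1 p rho - 2 * reeb P p rho).
set b := e2 p _; lra.
Qed.

End RhoDerivatives.

Section BoundaryJet.
Context {R : realType} {M : manifold R} (P : pseudohermitian M).
Context (nab : covd M) (hnab : tanaka_webster P nab).
Context (U : set M) (delta : M -> R) (ex : M -> R -> M) (foot : M -> M).
Context (rho : M -> R) (e1 e2 : vf M).
Context (hU : geodesic_collar P nab U delta ex foot rho e1 e2).
Context (om : form1 M) (hom : connection_form nab U e1 e2 om).
Context (a1 a2 : M -> R) (ha : torsion_coefficients P nab U e1 e2 a1 a2).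
Context (alpha : M -> R).
Context (halpha : forall x, boundary M x -> U x ->
  boundary_tangent x (reeb P x + alpha x *: e2 x)).
Context (x : M) (bx : boundary M x) (Ux : U x).
Implicit Types (p q : M) (f : M -> R).

Let oU : open U := collar_open hU.
Let ve1 : vfield U e1 := (collar_xi_e1 hnab hU).1.
Let te1 p (Up : U p) : tangent p (e1 p) := ve1.1 p Up.
Let vT : vfield U (reeb P) := vfield_sub (@subsetT _ U) (reeb_field P).
Let srho : smooth_on U rho := collar_rho_smooth hU.
Let bt1 : boundary_tangent x (e1 x).
Proof. by have [] := collar_e1_unit hU bx Ux. Qed.

Let g := apply_vf e1 rho.
Let tau := apply_vf (reeb P) rho.
Let sg : smooth_on U g.
Proof. by move=> p Up; exact: vfield_smooth ve1 Up (srho Up). Qed.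
Let stau : smooth_on U tau.
Proof. by move=> p Up; exact: vfield_smooth vT Up (srho Up). Qed.

Let near_boundary f : (forall q, boundary M q -> U q -> f q = 0) ->
  \forall q \near x, boundary M q -> f q = 0.
Proof. by move=> f0; apply: filterS (collar_near hU Ux) => q Uq bq; exact: f0. Qed.

Let rho0 q : boundary M q -> U q -> rho q = 0.
Proof. exact: collar_rho0 hU q. Qed.

Let g0 q : boundary M q -> U q -> g q = 0.
Proof.
move=> bq Uq; have [bt _ _] := collar_e1_unit hU bq Uq.
apply: bt.2; first exact: srho.
by apply: filterS (collar_near hU Uq) => r Ur br; exact: rho0.
Qed.

Let tau_alpha q : boundary M q -> U q -> tau q = - alpha q.
Proof.
move=> bq Uq; have [_ /(_ rho (srho Uq))] := halpha bq Uq.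
have -> : (reeb P q + alpha q *: e2 q) rho = tau q + alpha q * e2 q rho by [].
rewrite (collar_e2_rho hU Uq) => H.
have /H : \forall r \near q, boundary M r -> rho r = 0.
  by apply: filterS (collar_near hU Uq) => r Ur br; exact: rho0.
lra.
Qed.

Lemma boundary_e2_e1_rho : e2 x g = - 2 * alpha x.
Proof.
rewrite (collar_e2_e1_rho hnab hU hom Ux) -[e1 x rho]/(g x) g0 //.
rewrite -[reeb P x rho]/(tau x) tau_alpha //; ring.
Qed.

Lemma boundary_e1_e1_rho : e1 x g = 0.
Proof. by apply: bt1.2; [exact: sg|exact: near_boundary g0]. Qed.

(* [T + alpha e2] is tangent to the boundary, where [g] vanishes. *)
Let T_g : reeb P x g = 2 * alpha x ^+ 2.
Proof.
have [_ /(_ g (sg Ux) (near_boundary g0))] := halpha bx Ux.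
have -> : (reeb P x + alpha x *: e2 x) g = reeb P x g + alpha x * e2 x g by [].
by rewrite boundary_e2_e1_rho expr2; set c := reeb P x g; lra.
Qed.

(* [T rho + alpha \o foot] vanishes on the boundary, to which [e1] is tangent.  That
   [alpha \o foot] is smooth near [x] follows from [alpha = - T rho] on the
   boundary. *)
Let e1_tau : e1 x tau = - e1 x (alpha \o foot).
Proof.
have sf : smooth_at x (fun q => tau (foot q)).
  have [_ +] := collar_foot_smooth hU Ux; apply.
  by rewrite (collar_foot_id hU bx Ux); exact: stau.
have -> : e1 x (alpha \o foot) = - e1 x (fun q => tau (foot q)).
  rewrite -(tangentN (te1 Ux) sf); apply: (tangent_local (te1 Ux)).
  apply: filterS (collar_near hU Ux) => q Uq /=.
  by have [bf Uf _ _] := collar_footK hU Uq; rewrite tau_alpha // opprK.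
rewrite opprK; apply/eqP; rewrite -subr_eq0.
rewrite -(tangentB (te1 Ux) (stau Ux) sf); apply/eqP.
apply: bt1.2; first exact: smooth_sub (stau Ux) sf.
by apply: near_boundary => q bq Uq; rewrite (collar_foot_id hU bq Uq) subrr.
Qed.

(** [[e1, e2]] applied to [e1 rho], where [e2 (e1 rho)] is given by [collar_e2_e1_rho]:
    the value is [2 T (e1 rho) + 2 e1 (T rho)]. *)
Lemma boundary_e2_e1_e1_rho :
  e2 x (apply_vf e1 g) = 4 * alpha x ^+ 2 - 2 * e1 x (alpha \o foot).
Proof.
have := congr1 (fun v : vec M => v g) (collar_bracket hnab hU hom Ux).
rewrite /= bracketE; last exact: sg.
rewrite -[RHS]/(- om x (e1 x) * e1 x g - 2 * reeb P x g).
rewrite boundary_e1_e1_rho T_g.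
pose h q := om q (e1 q).
have sh : smooth_at x h by exact: oneform_smooth oU hom.1 ve1 x Ux.
have -> : e1 x (apply_vf e2 g) = 2 * e1 x tau.
  have E : \forall q \near x, apply_vf e2 g q = h q * g q + 2 * tau q.
    apply: filterS (collar_near hU Ux) => q Uq.
    exact: etrans (collar_e2_e1_rho hnab hU hom Uq) _.
  rewrite (tangent_local (te1 Ux) E).
  rewrite (tangentD (te1 Ux) (smooth_mul sh (sg Ux)) (smooth_scale 2 (stau Ux))).
  rewrite (tangentM (te1 Ux) sh (sg Ux)) (tangentZ _ (te1 Ux) (stau Ux)).
  by rewrite boundary_e1_e1_rho g0 // mulr0 mul0r !add0r.
rewrite e1_tau; set b := e2 x _; set c := e1 x _; lra.
Qed.

(** [[T, e1]] applied to [rho]: the left-hand side is [T (e1 rho) - e1 (T rho)]. *)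
Lemma boundary_om_reeb :
  om x (reeb P x) = e1 x (alpha \o foot) + 2 * alpha x ^+ 2 - a2 x.
Proof.
have := congr1 (fun v : vec M => v rho) (collar_bracket_reeb hnab hU hom ha Ux).
rewrite /= bracketE; last exact: srho.
rewrite -[RHS]/(om x (reeb P x) * e2 x rho - (a1 x * g x - a2 x * e2 x rho)).
rewrite (collar_e2_rho hU Ux) g0 // T_g.
rewrite -[e1 x (apply_vf _ _)]/(e1 x tau) e1_tau; set c := e1 x _; lra.
Qed.

End BoundaryJet.

(** * Limits at 0 from the right *)
Section RightLimits.
Context {R : realType}.
Implicit Types (f g : R -> R) (a b : R).

Definition lim0 f a : Prop := f s @[s --> 0^'+] --> a.

Lemma lim0_eq f a b : lim0 f a -> a = b -> lim0 f b.
Proof. by move=> H <-. Qed.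

Lemma lim0_near f g a : (\forall s \near 0^'+, f s = g s) -> lim0 f a -> lim0 g a.
Proof. by move=> fg; apply: cvg_trans; exact: near_eq_cvg. Qed.

Lemma lim0_cst a : lim0 (fun=> a) a.
Proof. exact: cvg_cst. Qed.

Lemma lim0_id : lim0 (fun s => s) 0.
Proof. by apply: cvg_within_filter; exact: cvg_id. Qed.

Lemma lim0D f g a b : lim0 f a -> lim0 g b -> lim0 (fun s => f s + g s) (a + b).
Proof. exact: cvgD. Qed.

Lemma lim0N f a : lim0 f a -> lim0 (fun s => - f s) (- a).
Proof. exact: cvgN. Qed.

Lemma lim0M f g a b : lim0 f a -> lim0 g b -> lim0 (fun s => f s * g s) (a * b).
Proof. exact: cvgM. Qed.

Lemma lim0X f a n : lim0 f a -> lim0 (fun s => f s ^+ n) (a ^+ n).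
Proof.
move=> H; elim: n => [|n IH]; first exact: cvg_cst.
rewrite exprS; apply: lim0_near (lim0M H IH); near=> s; by rewrite exprS.
Unshelve. all: by end_near. Qed.

Lemma lim0_unique f a b : lim0 f a -> lim0 f b -> a = b.
Proof. exact: cvg_unique. Qed.

Lemma lim0_squeeze f g : (\forall s \near 0^'+, `|f s| <= g s) -> lim0 g 0 -> lim0 f 0.
Proof.
move=> fg g0; apply/cvgrPdist_lt => e e0.
have /cvgrPdist_lt/(_ e e0) := g0; apply: filterS2 fg => s fs.
rewrite !sub0r !normrN; apply: le_lt_trans; apply: le_trans fs _; exact: ler_norm.
Qed.

(** For [s < 1], [- ln s = ln (1 / s) < 1 / s]. *)
Lemma lim0_sqr_ln : lim0 (fun s => s ^+ 2 * ln s) 0.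
Proof.
apply: (lim0_squeeze (g := fun s => s)); last exact: lim0_id.
near=> s; have s0 : 0 < s by [].
have s1 : s < 1 by near: s; exact: nbhs_right_lt.
have l0 : ln s <= 0 by rewrite ln_le0 // ltW.
have := @ln_sublinear R s^-1; rewrite invr_gt0 lnV ?posrE // => /(_ s0) l1.
rewrite normrM (ler0_norm l0) ger0_norm ?sqr_ge0 //.
apply: (@le_trans _ _ (s ^+ 2 * s^-1)); last by rewrite expr2 mulfK ?gt_eqF.
by apply: ler_wpM2l; [exact: sqr_ge0|exact: ltW].
Unshelve. all: by end_near. Qed.

Lemma bigO_lim0 f g k : (f : R -> R^o) =O_ (0^'+) (g : R -> R^o) ->
  lim0 (fun s => g s * k s) 0 -> lim0 (fun s => f s * k s) 0.
Proof.
move=> /eqO_exP[c c0 fg] gk.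
apply: (lim0_squeeze (g := fun s => c * `|g s * k s|)).
  apply: filterS fg => s fs; rewrite !normrM mulrA.
  by apply: ler_wpM2r.
have : lim0 (fun s => `|g s * k s|) 0.
  by rewrite -[X in lim0 _ X](normr0 R); exact: cvg_norm.
by move=> /(lim0M (@lim0_cst c)) H; apply: lim0_eq H _; rewrite mulr0.
Qed.

End RightLimits.

(** Computes the limit of a polynomial expression in functions whose limits are
    hypotheses.  The match is syntactic, so that these functions are never
    unfolded. *)
Ltac lim0_tac :=
  lazymatch goal with
  | |- lim0 (fun s => @GRing.add _ (@?f s) (@?g s)) _ =>
      refine (@lim0D _ f g _ _ _ _); lim0_tac
  | |- lim0 (fun s => @GRing.opp _ (@?f s)) _ =>
      refine (@lim0N _ f _ _); lim0_tac
  | |- lim0 (fun s => @GRing.mul _ (@?f s) (@?g s)) _ =>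
      refine (@lim0M _ f g _ _ _ _); lim0_tac
  | |- lim0 (fun s => @GRing.exp _ (@?f s) ?n) _ =>
      refine (@lim0X _ f _ n _); lim0_tac
  | |- lim0 (fun s => s) _ => exact: lim0_id
  | |- lim0 (fun _ => ?a) _ => exact (@lim0_cst _ a)
  | |- lim0 _ _ => eassumption
  end.

(** * Derivatives along a vector field *)
Section FieldDerivatives.
Context {R : realType} {M : manifold R}.
Context (U : set M) (X : vf M) (vX : vfield U X).
Context (V : set M) (oV : open V) (VU : V `<=` U).
Implicit Types (f g df dg : M -> R).

(** A form of the derivative of [f] along [X] that can be computed bottom-up, with
    [df] any expression that is correct on [V]. *)
Definition has_derivative f df : Prop :=
  forall p, V p -> smooth_at p f /\ X p f = df p.

Let tX p (Vp : V p) : tangent p (X p) := vX.1 p (VU Vp).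

Lemma has_derivative_apply f : smooth_on V f -> has_derivative f (apply_vf X f).
Proof. by move=> sf p Vp; split=> //; exact: sf. Qed.

Lemma has_derivative_eq f df dg : has_derivative f df ->
  (forall p, V p -> df p = dg p) -> has_derivative f dg.
Proof. by move=> H E p Vp; have [? ->] := H p Vp; rewrite E. Qed.

Lemma has_derivative_cst a : has_derivative (fun=> a) (fun=> 0).
Proof. by move=> p Vp; split; [exact: smooth_cst|exact: tangent_cst (tX Vp)]. Qed.

Lemma has_derivativeD f g df dg : has_derivative f df -> has_derivative g dg ->
  has_derivative (fun p => f p + g p) (fun p => df p + dg p).
Proof.
move=> Hf Hg p Vp; have [sf <-] := Hf p Vp; have [sg <-] := Hg p Vp.
by split; [exact: smooth_add|exact: tangentD (tX Vp) sf sg].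
Qed.

Lemma has_derivativeM f g df dg : has_derivative f df -> has_derivative g dg ->
  has_derivative (fun p => f p * g p) (fun p => f p * dg p + g p * df p).
Proof.
move=> Hf Hg p Vp; have [sf <-] := Hf p Vp; have [sg <-] := Hg p Vp.
by split; [exact: smooth_mul|exact: tangentM (tX Vp) sf sg].
Qed.

Lemma has_derivativeX f df n : has_derivative f df ->
  has_derivative (fun p => f p ^+ n.+1) (fun p => n.+1%:R * f p ^+ n * df p).
Proof.
move=> Hf; elim: n => [|n IH].
  by apply: has_derivative_eq Hf _ => p Vp; rewrite expr0 !mul1r.
have -> : (fun p => f p ^+ n.+2) = (fun p => f p * f p ^+ n.+1).
  by apply/funext => p; rewrite exprS.
apply: has_derivative_eq (has_derivativeM Hf IH) _ => p Vp.
by rewrite -[n.+2%:R]natr1 exprS; ring.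
Qed.

Lemma has_derivative_ln f df : (forall p, V p -> 0 < f p) -> has_derivative f df ->
  has_derivative (fun p => ln (f p)) (fun p => df p / f p).
Proof.
move=> f0 Hf p Vp; have [sf <-] := Hf p Vp; have fp := f0 p Vp.
by split; [exact: (smooth_ln_quot 0)|exact: tangent_ln (tX Vp) fp sf].
Qed.

(** A vector sends functions that are not smooth to 0, whence the need for
    the smoothness of [f] and [df] before the derivatives of [u - f] can be
    separated into those of [u] and those of [f]. *)
Lemma derivatives_from_difference u f df ddf : smooth_on V u ->
  has_derivative f df -> has_derivative df ddf ->
  forall p, V p ->
    X p u = X p (fun q => u q - f q) + df p /\
    X p (apply_vf X u) = X p (apply_vf X (fun q => u q - f q)) + ddf p.
Proof.
move=> su Hf Hdf p Vp.
have E q : V q -> X q (fun q => u q - f q) = X q u - df q.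
  move=> Vq; have [sf <-] := Hf q Vq; exact: tangentB (tX Vq) (su q Vq) sf.
split; first by rewrite E // subrK.
have [sdf <-] := Hdf p Vp.
have sXu : smooth_at p (apply_vf X u) := vX.2 p u (VU Vp) (su p Vp).
apply/eqP; rewrite -subr_eq -(tangentB (tX Vp) sXu sdf); apply/eqP.
apply: (tangent_local (tX Vp)).
by apply: filterS (open_nbhs_nbhs (conj oV Vp)) => q Vq; rewrite -E.
Qed.

End FieldDerivatives.


Ltac has_derivative_tac vX VU :=
  lazymatch goal with
  | |- has_derivative _ _ (fun p => @GRing.add _ (@?f p) (@?g p)) _ =>
      refine (@has_derivativeD _ _ _ _ vX _ VU f g _ _ _ _);
      has_derivative_tac vX VU
  | |- has_derivative _ _ (fun p => @GRing.mul _ (@?f p) (@?g p)) _ =>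
      refine (@has_derivativeM _ _ _ _ vX _ VU f g _ _ _ _);
      has_derivative_tac vX VU
  | |- has_derivative _ _ (fun p => @GRing.exp _ (@?f p) (S ?n)) _ =>
      refine (@has_derivativeX _ _ _ _ vX _ VU f _ n _);
      has_derivative_tac vX VU
  | |- has_derivative _ _ (fun _ => ?a) _ =>
      exact (@has_derivative_cst _ _ _ _ vX _ VU a)
  | |- has_derivative _ _ _ _ => eassumption
  end.

(** * Comparison of the coefficients of the equation *)
Section Coefficients.
Context {R : realType}.

(** The functions stand for [u], [e1 u], [e2 u], [e1 (e1 u)], [e2 (e2 u)], [om e1],
    [om e2] and the curvature along the geodesic with parameter [s].  The left-hand
    side of the equation minus 1 is [s (3 v + H / 2) + s ^ 2 Z s] with [Z]
    convergent; as it is [o(s ^ 2)], [3 v + H / 2 = 0] and the limit of [Z] is 0. *)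
Lemma compare_coefficients (u u1 u2 u11 u22 h1 h2 K : R -> R) (v w al ka H N k : R) :
  lim0 (fun s => (u s - s) / s ^+ 2) v ->
  lim0 (fun s => (u2 s - 1 - 2 * v * s) / s ^+ 2) (3 * w) ->
  lim0 (fun s => (u22 s - 2 * v) / s) (6 * w) ->
  lim0 (fun s => u1 s / s) (- 2 * al) ->
  lim0 (fun s => u11 s / s) ka ->
  lim0 (fun s => (h1 s - H) / s) N ->
  (\forall s \near 0^'+, h2 s = 0) ->
  lim0 K k ->
  lim0 (fun s => (u1 s ^+ 2 + u2 s ^+ 2
    - 2^-1 * u s * (u11 s + u22 s - h1 s * u2 s + h2 s * u1 s)
    - 8^-1 * (2 * K s) * u s ^+ 2 - 1) / s ^+ 2) 0 ->
  v = - H / 6 /\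
  3 * w = - (2 * al ^+ 2 + 2^-1 * (4 * al ^+ 2 - ka) + 2^-1 * N - 4^-1 * k
             - H ^+ 2 / 6).
Proof.
set A := fun s => _ / _ => LA; set B := fun s => _ / _ => LB.
set C := fun s => _ / _ => LC; set G := fun s => _ / _ => LG.
set Q := fun s => _ / _ => LQ; set F := fun s => _ / _ => LF.
move=> h20 LK; set eps := fun s => _ / _ => Leps.
pose X s := Q s + C s - F s * (1 + 2 * v * s + s ^+ 2 * B s)
  - H * (2 * v + s * B s).
pose Z s := G s ^+ 2 + 4 * v ^+ 2 + 2 * B s + 4 * v * s * B s + s ^+ 2 * B s ^+ 2
  - 2^-1 * (X s + A s * (2 * v - H + s * X s)) - 4^-1 * K s * (1 + s * A s) ^+ 2.
have E : \forall s \near 0^'+, s * eps s = 3 * v + H / 2 + s * Z s.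
  near=> s; have s0 : s != 0 by rewrite gt_eqF.
  have h2s : h2 s = 0 by near: s.
  have Eu : u s = s + s ^+ 2 * A s by rewrite /A; field.
  have Eu2 : u2 s = 1 + 2 * v * s + s ^+ 2 * B s by rewrite /B; field.
  have Eu22 : u22 s = 2 * v + s * C s by rewrite /C; field.
  have Eu1 : u1 s = s * G s by rewrite /G; field.
  have Eu11 : u11 s = s * Q s by rewrite /Q; field.
  have Eh1 : h1 s = H + s * F s by rewrite /F; field.
  rewrite /eps h2s Eu Eu2 Eu22 Eu1 Eu11 Eh1 /Z /X.
  move: (A s) (B s) (C s) (G s) (Q s) (F s) (K s) => a b c g q f kk.
  by field.
clearbody A B C G Q F eps.
have LZ : lim0 Z (4 * al ^+ 2 + 4 * v ^+ 2 + 6 * w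
   - 2^-1 * (ka + 6 * w - N - 2 * v * H + v * (2 * v - H)) - 4^-1 * k).
  by apply: lim0_eq; [rewrite /Z /X; lim0_tac|ring].
have v0 : 3 * v + H / 2 = 0.
  apply: (@lim0_unique _ (fun=> 3 * v + H / 2)); first exact: lim0_cst.
  apply: (@lim0_near _ (fun s => s * eps s - s * Z s)).
    by apply: filterS E => s ->; ring.
  by apply: lim0_eq; [clearbody Z; lim0_tac|ring].
have Z0 : 4 * al ^+ 2 + 4 * v ^+ 2 + 6 * w
   - 2^-1 * (ka + 6 * w - N - 2 * v * H + v * (2 * v - H)) - 4^-1 * k = 0.
  apply: (lim0_unique LZ); apply: lim0_near Leps.
  near=> s; have s0 : s != 0 by rewrite gt_eqF.
  apply: (mulfI s0); have -> : s * eps s = 3 * v + H / 2 + s * Z s by near: s.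
  by rewrite v0 add0r.
have Ev : v = - H / 6 by lra.
split=> //; move: Z0; rewrite Ev => Z0.
have {}Z0 : 3 * w + (2 * al ^+ 2 + 2^-1 * (4 * al ^+ 2 - ka) + 2^-1 * N - 4^-1 * k
             - H ^+ 2 / 6) = 0 by rewrite -[RHS]Z0; field.
lra.
Unshelve. all: by end_near. Qed.

End Coefficients.

(** * The derivatives of a formal solution along a geodesic *)
Section Expansion.
Context {R : realType} {M : manifold R} (P : pseudohermitian M).
Context (nab : covd M) (hnab : tanaka_webster P nab).
Context (U : set M) (delta : M -> R) (ex : M -> R -> M) (foot : M -> M).
Context (rho : M -> R) (e1 e2 : vf M).
Context (hU : geodesic_collar P nab U delta ex foot rho e1 e2).
Context (om : form1 M) (K : M -> R).
Context (u v w z l h : M -> R).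
Context (hu : formal_solution U ex foot rho e1 e2 om K u v w z l h).
Context (x : M) (bx : boundary M x) (Ux : U x).
Implicit Types (p q : M) (f : M -> R) (s : R).

Let ve2 : vfield U e2 := collar_e2 hU.
Let srho : smooth_on U rho := collar_rho_smooth hU.

Lemma collar_right f : smooth_at x f ->
  lim0 (fun s => (f (ex x s) - f x) / s) (e2 x f).
Proof.
move=> sf; have [d0 E0] := collar_ex0 hU bx Ux.
have d0' : 0 <= (0 : R) < delta x by rewrite lexx.
have := velocity_right (collar_velocity hU bx Ux d0').
by rewrite E0; apply.
Qed.

Lemma collar_right_cont f : smooth_at x f -> lim0 (fun s => f (ex x s)) (f x).
Proof.
move=> sf; have [d0 E0] := collar_ex0 hU bx Ux.
have d0' : 0 <= (0 : R) < delta x by rewrite lexx.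
have := velocity_right_cont (collar_velocity hU bx Ux d0') (f := f).
by rewrite E0; apply.
Qed.

(* The interior of the collar, where [ln rho] is smooth. *)
Let V := [set p | U p /\ 0 < rho p].
Let VU : V `<=` U. Proof. by move=> p []. Qed.

Let oV : open V.
Proof.
rewrite openE => p [Up rp]; apply: filterI; first exact: collar_near hU p Up.
have cr : rho @ p --> rho p := smooth_cont (srho Up).
exact: cvgr_gt cr _ rp.
Qed.

Let su : smooth_on V u.
Proof.
move=> p [Up rp]; have Ip : (U `\` boundary M) p.
  by split=> // bp; move: rp; rewrite (collar_rho0 hU bp Up) ltxx.
exact: fs_smooth hu p Ip.
Qed.

(** Near the foot of [p], [c] agrees on the boundary with a smooth function, and the
    foot map takes its values in the boundary. *)
Lemma smooth_foot c : smooth_on_boundary (boundary M `&` U) c ->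
  smooth_on U (fun p => c (foot p)).
Proof.
move=> sc p Up; have [bf Uf _ _] := collar_footK hU Up.
have [F sF Fc] := sc (foot p) (conj bf Uf).
have [cf sf] := collar_foot_smooth hU Up.
apply: smooth_ext (sf F sF).
have cf' : foot @ p --> foot p := cf.
have {}Fc : \forall q \near p, boundary M (foot q) -> F (foot q) = c (foot q).
  exact: cf' _ Fc.
apply: filterS2 Fc (collar_near hU Up) => q /= Fq Uq; apply: Fq.
by have [] := collar_footK hU Uq.
Qed.

Let near_collar : \forall s \near 0^'+, 0 < s < delta x.
Proof.
have [d0 _] := collar_ex0 hU bx Ux.
near=> s; apply/andP; split=> //; near: s; exact: nbhs_right_lt.
Unshelve. all: by end_near. Qed.

Let ex_V s : 0 < s < delta x -> V (ex x s).
Proof.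
move=> /andP[s0 sd]; have [|Us _ rs] := collar_exK hU bx Ux (s := s); first by rewrite sd ltW.
by split=> //; rewrite rs.
Qed.

Lemma collar_e2_foot c : smooth_on U (fun p => c (foot p)) ->
  has_derivative e2 V (fun p => c (foot p)) (fun=> 0).
Proof.
move=> sc p [Up rp]; split; first exact: sc.
have [bf Uf sd Ep] := collar_footK hU Up.
have vel := collar_velocity hU bf Uf sd.
have sd' : 0 < rho p < delta (foot p) by rewrite rp; case/andP: sd.
have := velocity_derive vel _ sd' (f := fun p => c (foot p)); rewrite Ep => /(_ (sc p Up)) D.
have D0 : is_derive (rho p) 1 (fun t => c (foot (ex (foot p) t))) (0 : R).
  apply: (@near_eq_is_derive _ _ _ (cst (c (foot p)) : R -> R)).
  have : \forall t \near rho p, t \in `]0, delta (foot p)[.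
    by apply: near_in_itvoo; rewrite in_itv.
  apply: filterS => t; rewrite in_itv /= => t0.
  have [|_ -> //] := collar_exK hU bf Uf (s := t).
  by case/andP: t0 => a ->; rewrite ltW.
by rewrite -(@derive_val _ _ _ _ _ _ _ D) (@derive_val _ _ _ _ _ _ _ D0).
Qed.

Let D p := u p - expansion foot rho v w z l h p.

(* At most two derivatives of the [O(rho ^ 6)] remainder leave [O(s ^ 4)], which
   is still [o(1)] after a division by [s ^ j] with [j <= 2]. *)
Let D_lim (Xs : seq (vf M)) j : (size Xs <= 2)%N -> (j <= 2)%N -> (size Xs + j < 6)%N ->
  (forall i, (i < size Xs)%N -> vfield U (nth e1 Xs i)) ->
  lim0 (fun s => foldr apply_vf D Xs (ex x s) * (s ^+ j)^-1) 0.
Proof.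
move=> sX j2 sj vXs; apply: (bigO_lim0 (fs_expansion hu vXs bx Ux)).
apply: (@lim0_near _ (fun s => s ^+ (6 - size Xs - j))).
  near=> s; have s0 : s != 0 by rewrite gt_eqF.
  have -> : (6%:Z - (size Xs)%:Z)%R = (6 - size Xs)%N.
    by rewrite subzn // (leq_trans sX).
  rewrite -exprnP -expfB //; lia.
have -> : (6 - size Xs - j = (5 - size Xs - j).+1)%N by lia.
apply: lim0_eq; first by apply: lim0X; exact: lim0_id.
by rewrite exprS mul0r.
Unshelve. all: by end_near. Qed.

(** [e2] acts on the expansion as the derivative in [rho] with constant coefficients;
    the logarithmic term contributes [O(s ^ 4 ln s)] and [O(s ^ 3 ln s)]. *)
Lemma expansion_e2 :
  [/\ lim0 (fun s => (u (ex x s) - s) / s ^+ 2) (v x),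
      lim0 (fun s => (e2 (ex x s) u - 1 - 2 * v x * s) / s ^+ 2) (3 * w x)
    & lim0 (fun s => (e2 (ex x s) (apply_vf e2 u) - 2 * v x) / s) (6 * w x)].
Proof.
have [sv sw sz sl sh] := fs_coef_smooth hu.
pose fv p := v (foot p); pose fw p := w (foot p); pose fz p := z (foot p).
pose fl p := l (foot p); pose fh p := h (foot p).
have dv : has_derivative e2 V fv (fun=> 0) := collar_e2_foot (smooth_foot sv).
have dw : has_derivative e2 V fw (fun=> 0) := collar_e2_foot (smooth_foot sw).
have dz : has_derivative e2 V fz (fun=> 0) := collar_e2_foot (smooth_foot sz).
have dl : has_derivative e2 V fl (fun=> 0) := collar_e2_foot (smooth_foot sl).
have dh : has_derivative e2 V fh (fun=> 0) := collar_e2_foot (smooth_foot sh).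
have dr : has_derivative e2 V rho (fun=> 1).
  by move=> p /VU Up; split; [exact: srho|by rewrite (collar_e2_rho hU Up)].
pose L p := ln (rho p).
have dL : has_derivative e2 V L (fun p => 1 / rho p).
  exact: (has_derivative_ln ve2 VU (fun p (Vp : V p) => Vp.2) dr).
have rn0 p : V p -> rho p != 0 by case=> _ rp; rewrite gt_eqF.
pose E p := rho p + fv p * rho p ^+ 2 + fw p * rho p ^+ 3 + fz p * rho p ^+ 4
  + fl p * (rho p ^+ 5 * L p) + fh p * rho p ^+ 5.
pose E1 p := 1 + 2 * fv p * rho p + 3 * fw p * rho p ^+ 2 + 4 * fz p * rho p ^+ 3
  + fl p * (5 * rho p ^+ 4 * L p + rho p ^+ 4) + 5 * fh p * rho p ^+ 4.
pose E2 p := 2 * fv p + 6 * fw p * rho p + 12 * fz p * rho p ^+ 2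
  + fl p * (20 * rho p ^+ 3 * L p + 9 * rho p ^+ 3) + 20 * fh p * rho p ^+ 3.
have dE : has_derivative e2 V E E1.
  apply: has_derivative_eq; first by rewrite /E; has_derivative_tac ve2 VU.
  by move=> p Vp; rewrite /E1 /=; field; exact: rn0.
have dE1 : has_derivative e2 V E1 E2.
  apply: has_derivative_eq; first by rewrite /E1; has_derivative_tac ve2 VU.
  by move=> p Vp; rewrite /E2 /=; field; exact: rn0.
have DE := derivatives_from_difference ve2 oV VU su dE dE1.
have DED : (fun q => u q - E q) = D by [].
rewrite DED in DE.
have vs (Xs : seq (vf M)) : Xs = [::] \/ Xs = [:: e2] \/ Xs = [:: e2; e2] ->
    forall i, (i < size Xs)%N -> vfield U (nth e1 Xs i).
  by case=> [->|[->|->]] [|[|i]].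
pose D0 s := D (ex x s) / s ^+ 2.
pose D1 s := e2 (ex x s) D / s ^+ 2.
pose D2 s := e2 (ex x s) (apply_vf e2 D) / s.
have LD0 : lim0 D0 0.
  by have := @D_lim [::] 2 isT isT isT (vs _ (or_introl erefl)).
have LD1 : lim0 D1 0.
  by have := @D_lim [:: e2] 2 isT isT isT (vs _ (or_intror (or_introl erefl))).
have LD2 : lim0 D2 0.
  by have := @D_lim [:: e2; e2] 1 isT isT isT (vs _ (or_intror (or_intror erefl))).
pose lam s : R := s ^+ 2 * ln s.
have Llam : lim0 lam 0 := @lim0_sqr_ln R.
have along s : 0 < s < delta x -> [/\ s != 0, V (ex x s), rho (ex x s) = s,
    foot (ex x s) = x & L (ex x s) = lam s / s ^+ 2].
  move=> s0; have sn0 : s != 0 by case/andP: s0 => s0 _; rewrite gt_eqF.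
  have [|_ fs rs] := collar_exK hU bx Ux (s := s).
    by case/andP: s0 => s0 ->; rewrite ltW.
  by split=> //; [exact: ex_V|rewrite /L rs /lam; field].
split.
- apply: (@lim0_near _ (fun s => D0 s +
    (v x + w x * s + z x * s ^+ 2 + l x * (s * lam s) + h x * s ^+ 3))).
    apply: filterS near_collar => s s0; have [sn0 Vs rs fs EL] := along s s0.
    rewrite /D0 -[D (ex x s)]/(u (ex x s) - E (ex x s)).
    by rewrite /E /fv /fw /fz /fl /fh fs rs EL; field.
  by apply: lim0_eq; [clearbody D0 lam; lim0_tac|ring].
- apply: (@lim0_near _ (fun s => D1 s +
    (3 * w x + 4 * z x * s + l x * (5 * lam s + s ^+ 2) + 5 * h x * s ^+ 2))).
    apply: filterS near_collar => s s0; have [sn0 Vs rs fs EL] := along s s0.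
    have [-> _] := DE _ Vs; rewrite /D1; set b := e2 _ D.
    by rewrite /E1 /fv /fw /fz /fl /fh fs rs EL; field.
  by apply: lim0_eq; [clearbody D1 lam; lim0_tac|ring].
- apply: (@lim0_near _ (fun s => D2 s +
    (6 * w x + 12 * z x * s + l x * (20 * lam s + 9 * s ^+ 2) + 20 * h x * s ^+ 2))).
    apply: filterS near_collar => s s0; have [sn0 Vs rs fs EL] := along s s0.
    have [_ ->] := DE _ Vs; rewrite /D2; set b := e2 _ (apply_vf e2 D).
    by rewrite /E2 /fv /fw /fz /fl /fh fs rs EL; field.
  by apply: lim0_eq; [clearbody D2 lam; lim0_tac|ring].
Qed.

Let ve1 : vfield U e1 := (collar_xi_e1 hnab hU).1.

(** In the expansion [rho + rho ^ 2 S + rho B Y], with [S] and [B] smooth up to the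
    boundary and [Y = rho ^ 2 ln rho], the first and second derivatives of [Y] tend
    to 0 because [e1 rho] and [e1 (e1 rho)] are [O(s)].  Hence those of
    [rho ^ 2 S + rho B Y] are [o(s)]. *)
Lemma expansion_e1 (al ka : R) :
  lim0 (fun s => e1 (ex x s) rho / s) al ->
  lim0 (fun s => e1 (ex x s) (apply_vf e1 rho) / s) ka ->
  lim0 (fun s => e1 (ex x s) u / s) al /\
  lim0 (fun s => e1 (ex x s) (apply_vf e1 u) / s) ka.
Proof.
move=> Lg Lg1; have [sv sw sz sl sh] := fs_coef_smooth hu.
pose S p := v (foot p) + (w (foot p) * rho p + (z (foot p) * rho p ^+ 2 + h (foot p) * rho p ^+ 3)).
pose B p := l (foot p) * rho p ^+ 2.
have sS : smooth_on U S.
  move=> p Up; have sr := srho Up.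
  apply: smooth_add; first exact: smooth_foot sv p Up.
  apply: smooth_add; first exact: smooth_mul (smooth_foot sw Up) sr.
  by apply: smooth_add; apply: smooth_mul (smooth_exp _ sr); exact: smooth_foot.
have sB : smooth_on U B.
  by move=> p Up; apply: smooth_mul (smooth_exp _ (srho Up)); exact: smooth_foot.
have s1 f : smooth_on U f -> smooth_on U (apply_vf e1 f).
  by move=> sf p Up; exact: vfield_smooth ve1 Up (sf p Up).
have d f : smooth_on U f -> has_derivative e1 V f (apply_vf e1 f).
  by move=> sf; apply: has_derivative_apply => p /VU; exact: sf.
have dr := d _ srho; have dg := d _ (s1 _ srho).
have dS := d _ sS; have dS1 := d _ (s1 _ sS).
have dB := d _ sB; have dB1 := d _ (s1 _ sB).
have sg : smooth_on U (apply_vf e1 rho) := s1 _ srho.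
have cg := collar_right_cont (sg x Ux); have cg1 := collar_right_cont (s1 _ sg x Ux).
have cS := collar_right_cont (sS x Ux); have cS1 := collar_right_cont (s1 _ sS x Ux).
have cS2 := collar_right_cont (s1 _ (s1 _ sS) x Ux).
have cB := collar_right_cont (sB x Ux); have cB1 := collar_right_cont (s1 _ sB x Ux).
have cB2 := collar_right_cont (s1 _ (s1 _ sB) x Ux).
set g := apply_vf e1 rho in Lg1 dr dg sg cg cg1.
rewrite -[fun s => e1 (ex x s) rho / s]/(fun s => g (ex x s) / s) in Lg.
set g1 := apply_vf e1 g in dg cg1.
rewrite -[fun s => e1 (ex x s) g / s]/(fun s => g1 (ex x s) / s) in Lg1.
set S1 := apply_vf e1 S in dS dS1 cS1 cS2; set S2 := apply_vf e1 S1 in dS1 cS2.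
set B1 := apply_vf e1 B in dB dB1 cB1 cB2; set B2 := apply_vf e1 B1 in dB1 cB2.
pose L p := ln (rho p).
have dl : has_derivative e1 V L (fun p => g p / rho p).
  exact: (has_derivative_ln ve1 VU (fun p (Vp : V p) => Vp.2) dr).
have rn0 p : V p -> rho p != 0 by case=> _ rp; rewrite gt_eqF.
(* [Y], [Z] and [Z1] are [rho ^ 2 ln rho] and its two derivatives along [e1]. *)
pose Y p := rho p ^+ 2 * L p.
pose Z p := g p * (rho p * (2 * L p + 1)).
pose Z1 p := (g1 p * rho p + g p ^+ 2) * (2 * L p + 1) + 2 * g p ^+ 2.
have dY : has_derivative e1 V Y Z.
  apply: has_derivative_eq; first by rewrite /Y; has_derivative_tac ve1 VU.
  by move=> p Vp; rewrite /Z; field; exact: rn0.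
have dZ : has_derivative e1 V Z Z1.
  apply: has_derivative_eq; first by rewrite /Z; has_derivative_tac ve1 VU.
  by move=> p Vp; rewrite /Z1; field; exact: rn0.
pose E p := rho p + (rho p ^+ 2 * S p + rho p * (B p * Y p)).
have EE : expansion foot rho v w z l h = E.
  by apply/funext => p; rewrite /expansion /E /S /B /Y /L; ring.
(* [E1] and [E2] are the two derivatives of the expansion [E] along [e1]. *)
pose E1 p := g p + (rho p ^+ 2 * S1 p + 2 * rho p * g p * S p)
  + (g p * (B p * Y p) + rho p * (B p * Z p + Y p * B1 p)).
pose E2 p := g1 p + (rho p ^+ 2 * S2 p + 4 * rho p * g p * S1 p
    + 2 * (rho p * g1 p + g p ^+ 2) * S p)
  + (g1 p * (B p * Y p) + 2 * g p * (B p * Z p + Y p * B1 p)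
    + rho p * (B p * Z1 p + 2 * B1 p * Z p + Y p * B2 p)).
have dE : has_derivative e1 V E E1.
  apply: has_derivative_eq; first by rewrite /E; has_derivative_tac ve1 VU.
  by move=> p Vp; rewrite /E1 /=; ring.
have dE1 : has_derivative e1 V E1 E2.
  apply: has_derivative_eq; first by rewrite /E1; has_derivative_tac ve1 VU.
  by move=> p Vp; rewrite /E2 /=; ring.
have DE := derivatives_from_difference ve1 oV VU su dE dE1.
have vs (Xs : seq (vf M)) : Xs = [:: e1] \/ Xs = [:: e1; e1] ->
    forall i, (i < size Xs)%N -> vfield U (nth e1 Xs i).
  by case=> -> [|[|i]].
pose D1 s := e1 (ex x s) D / s; pose D2 s := e1 (ex x s) (apply_vf e1 D) / s.
have LD1 : lim0 D1 0.
  by have := @D_lim [:: e1] 1 isT isT isT (vs _ (or_introl erefl)).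
have LD2 : lim0 D2 0.
  by have := @D_lim [:: e1; e1] 1 isT isT isT (vs _ (or_intror erefl)).
have DED : (fun q => u q - E q) = D by rewrite -EE.
rewrite DED in DE.
have Llam := @lim0_sqr_ln R.
pose G s := g (ex x s) / s; pose G1 s := g1 (ex x s) / s.
have LG : lim0 G al := Lg.
have LG1 : lim0 G1 ka := Lg1.
pose lam s : R := s ^+ 2 * ln s.
have {}Llam : lim0 lam 0 := Llam.
have along s : 0 < s < delta x -> [/\ s != 0, V (ex x s) & [/\ rho (ex x s) = s,
    g (ex x s) = s * G s, g1 (ex x s) = s * G1 s & L (ex x s) = lam s / s ^+ 2]].
  move=> s0; have sn0 : s != 0 by case/andP: s0 => s0 _; rewrite gt_eqF.
  have [|_ _ rs] := collar_exK hU bx Ux (s := s).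
    by case/andP: s0 => s0 ->; rewrite ltW.
  by split; [|exact: ex_V|split; [|rewrite /G; field|rewrite /G1; field|rewrite /L rs /lam; field]].
have vanish f F a : lim0 (fun s => f (ex x s)) (f x) -> lim0 F a ->
    (forall s, 0 < s < delta x -> f (ex x s) = s * F s) -> f x = 0.
  move=> cf LF fE; apply: (lim0_unique cf); rewrite -(mul0r a).
  apply: lim0_near (lim0M (@lim0_id R) LF).
  by apply: filterS near_collar => s /fE.
have g0 : g x = 0 by apply: vanish cg LG _ => s /along[_ _ []].
have g10 : g1 x = 0 by apply: vanish cg1 LG1 _ => s /along[_ _ []].
split.
- apply: (@lim0_near _ (fun s => D1 s +
    (G s + s * (s * 0 + S1 (ex x s)) + 2 * g (ex x s) * S (ex x s)
     + (G s * (B (ex x s) * lam s) + (B (ex x s) * (G s * (2 * lam s + s ^+ 2))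
        + lam s * B1 (ex x s)))))).
    apply: filterS near_collar => s s0; have [sn0 Vs [rs Eg Eg1 EL]] := along s s0.
    have [-> _] := DE _ Vs; rewrite [RHS]mulrDl; congr (_ + _).
    by rewrite /E1 /Y /Z rs EL Eg; field.
  by apply: lim0_eq; [clearbody G G1 lam D1 D2; lim0_tac|rewrite g0; ring].
- apply: (@lim0_near _ (fun s => D2 s +
    (G1 s + (s * S2 (ex x s) + 4 * g (ex x s) * S1 (ex x s)
      + 2 * (g1 (ex x s) + G s * g (ex x s)) * S (ex x s))
     + (G1 s * (B (ex x s) * lam s)
        + 2 * G s * (B (ex x s) * (G s * (2 * lam s + s ^+ 2)) + lam s * B1 (ex x s))
        + (B (ex x s) * ((G1 s + G s ^+ 2) * (2 * lam s + s ^+ 2) + 2 * g (ex x s) ^+ 2)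
          + 2 * B1 (ex x s) * (G s * (2 * lam s + s ^+ 2)) + lam s * B2 (ex x s)))))).
    apply: filterS near_collar => s s0; have [sn0 Vs [rs Eg Eg1 EL]] := along s s0.
    have [_ ->] := DE _ Vs; rewrite [RHS]mulrDl; congr (_ + _).
    by rewrite /E2 /Y /Z /Z1 rs EL Eg Eg1; field.
  by apply: lim0_eq; [clearbody G G1 lam D1 D2; lim0_tac|rewrite g0 g10; ring].
Qed.

End Expansion.

Theorem proposition15 (R : realType) (M : manifold R) (P : pseudohermitian M)
    (nab : covd M) (hnab : tanaka_webster P nab)
    (W : M -> R) (hW : webster_curvature P nab W)
    (U : set M) (delta : M -> R) (ex : M -> R -> M) (foot : M -> M)
    (rho : M -> R) (e1 e2 : vf M)
    (hU : geodesic_collar P nab U delta ex foot rho e1 e2)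
    (om : form1 M) (hom : connection_form nab U e1 e2 om)
    (a1 a2 : M -> R) (ha : torsion_coefficients P nab U e1 e2 a1 a2)
    (alpha : M -> R)
    (halpha : forall x, boundary M x -> U x ->
       boundary_tangent x (reeb P x + alpha x *: e2 x))
    (H : M -> R)
    (hH : forall x, boundary M x -> U x -> H x = om x (e1 x))
    (u v w z l h : M -> R)
    (hu : formal_solution U ex foot rho e1 e2 om W u v w z l h) :
  forall x, boundary M x -> U x ->
    w x = - (2 / 3) *
      (e1 x (alpha \o foot) + 2 * alpha x ^+ 2 + 1 / 6 * H x ^+ 2
       + 3 / 16 * scalar_curvature W x - 1 / 2 * a2 x).

Proof.
move=> x bx Ux.
have oU := collar_open hU; have ve2 := collar_e2 hU.
have ve1 := (collar_xi_e1 hnab hU).1.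
have srho := collar_rho_smooth hU.
have vT : vfield U (reeb P) := vfield_sub (@subsetT _ U) (reeb_field P).
have sg : smooth_on U (apply_vf e1 rho).
  by move=> p Up; exact: vfield_smooth ve1 Up (srho p Up).
have sg1 : smooth_on U (apply_vf e1 (apply_vf e1 rho)).
  by move=> p Up; exact: vfield_smooth ve1 Up (sg p Up).
pose k q := om q (e1 q).
have sk : smooth_on U k := oneform_smooth oU hom.1 ve1.
have g0 : e1 x rho = 0.
  have [bt _ _] := collar_e1_unit hU bx Ux.
  apply: bt.2; first exact: srho.
  by apply: filterS (collar_near hU Ux) => q Uq bq; exact: collar_rho0 hU q bq Uq.
have Lg : lim0 (fun s => e1 (ex x s) rho / s) (- 2 * alpha x).
  rewrite -(boundary_e2_e1_rho hnab hU hom halpha bx Ux).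
  apply: lim0_near (collar_right hU bx Ux (sg x Ux)).
  by apply: nearW => s; rewrite /apply_vf g0 subr0.
have Lg1 : lim0 (fun s => e1 (ex x s) (apply_vf e1 rho) / s)
    (4 * alpha x ^+ 2 - 2 * e1 x (alpha \o foot)).
  rewrite -(boundary_e2_e1_e1_rho hnab hU hom halpha bx Ux).
  apply: lim0_near (collar_right hU bx Ux (sg1 x Ux)).
  by apply: nearW => s; rewrite /apply_vf (boundary_e1_e1_rho hnab hU bx Ux) subr0.
have [Lu1 Lu11] := expansion_e1 hnab hU hu bx Ux Lg Lg1.
have [Lu Lu2 Lu22] := expansion_e2 hU hu bx Ux.
have Lk := collar_right hU bx Ux (sk x Ux).
have near_s : \forall s \near 0^'+, U (ex x s).
  have [d0 _] := collar_ex0 hU bx Ux.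
  near=> s; have s0 : 0 < s by [].
  have sd : s < delta x by near: s; exact: nbhs_right_lt.
  by have [|] := collar_exK hU bx Ux (s := s); first by rewrite ltW.
have om0 : \forall s \near 0^'+, om (ex x s) (e2 (ex x s)) = 0.
  by apply: filterS near_s => s Us; rewrite (collar_om_e2 hnab hU hom Us).
(* [W] is a priori any function; the curvature formula makes it smooth. *)
have LW : lim0 (fun s => W (ex x s)) (W x).
  pose F p := 2^-1 * (e2 p k - om p (e1 p) ^+ 2 - 2 * om p (reeb P p)).
  have FW p : U p -> F p = W p.
    by move=> Up; rewrite /F (collar_curvature hnab hU hom hW Up); field.
  have sF : smooth_at x F.
    apply/smooth_scale/smooth_sub; last first.
      by apply: smooth_scale; exact: oneform_smooth oU hom.1 vT x Ux.
    apply: smooth_sub; first exact: vfield_smooth ve2 Ux (sk x Ux).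
    exact: smooth_exp (sk x Ux).
  rewrite -(FW x Ux); apply: lim0_near (collar_right_cont hU bx Ux sF).
  by apply: filterS near_s => s; exact: FW.
have Leq := bigO_lim0 (k := fun s => (s ^+ 2)^-1) (fs_equation hu bx Ux).
(* The error [s ^ 5 ln s] of the equation is [o(s ^ 2)]. *)
have Lrem : lim0 (fun s : R => s ^+ 5 * ln s * (s ^+ 2)^-1) 0.
  apply: (@lim0_near _ (fun s : R => s * (s ^+ 2 * ln s))).
    near=> s; have s0 : s != 0 by rewrite gt_eqF.
    by field.
  by apply: lim0_eq (lim0M (@lim0_id R) (@lim0_sqr_ln R)) _; rewrite mulr0.
have [Ev Ew] := compare_coefficients Lu Lu2 Lu22 Lu1 Lu11 Lk om0 LW (Leq Lrem).
move: Ew; rewrite (collar_curvature hnab hU hom hW Ux).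
rewrite (boundary_om_reeb hnab hU hom ha halpha bx Ux) -[k x]/(om x (e1 x)) -hH //.
rewrite /scalar_curvature => Ew.
apply: (@mulfI _ 3); first by rewrite pnatr_eq0.
by rewrite Ew; field.
Unshelve. all: by end_near. Qed.
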